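(* As $\varepsilon\to0$, the energy $$E_\varepsilon[H]=\int_0^\lambda\Big[\frac{\varepsilon}{2}(H')^2+W^*(H)\Big]dy$$ of a broken solution $H_b$ is $$E_\varepsilon[H_b]=\sqrt{\varepsilon}\int_0^1\sqrt{2W^*(H)}\,dH+o(\sqrt\varepsilon)=\sqrt\varepsilon\int_1^\infty\sqrt{2W(F)/F^5}\,dF+o(\sqrt\varepsilon).$$
   Context: Let $W\in C^3(0,\infty)$ satisfy: $W(F)\nearrow\infty$ as $F\searrow0$; $W(F)\nearrow\gamma>0$ as $F\nearrow\infty$; $W(1)=0$ and $W(F)>0$ for $F\ne1$; $W$ is strictly convex on $(0,1/\kappa)$ and strictly concave on $(1/\kappa,\infty)$, where $0<\kappa<1$. Define $W^*(H)=HW(1/H)$ for $H>0$, $W^*(0)=0$, $W^*(H)=+\infty$ for $H<0$. Dots denote derivatives with respect to the argument, and $\dot W^*(0):=\dot W^*(0^+)=\gamma$. Then $W^*\in C^3(0,\infty)$, $W^*(1)=0$, $W^*>0$ on $(0,\infty)\setminus\{1\}$, and $W^*$ is strictly concave on $[0,\kappa)$ and strictly convex on $(\kappa,\infty)$. Here $\varepsilon>0$. $\mathcal H=\{v\in H^1(0,1):\int_0^1 v\,ds=0\}$ is the Hilbert space with inner product $\langle u,v\rangle=\int_0^1u'v'\,ds$, $\mathcal K=\{v\in\mathcal H: v\ge-1\text{ on }[0,1]\}$, $\mathcal K^o=\{v\in\mathcal K: v>-1\text{ on }[0,1]\}$, and $\partial\mathcal K=\mathcal K\setminus\mathcal K^o$.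 A solution pair is $(\lambda,u)\in(0,\infty)\times\mathcal K$ with $$\int_0^1\Big[\varepsilon u'(v-u)'+\lambda^3\dot W^*\big([1+u]/\lambda\big)(v-u)\Big]ds\ \ge\ 0\qquad\text{for all } v\in\mathcal K ;$$ it is nontrivial if $u\ne0$ ($u\equiv0$ is a solution for every $\lambda>0$). The shape of the graph of $\ddot W^*$ is such that for each $n\in\mathbb N$ the characteristic equation $\varepsilon n^2\pi^2/\lambda^2=-\ddot W^*(1/\lambda)$ has exactly one root $\lambda=\lambda_n>0$, which is simple and transversal (the two sides, as functions of $1/\lambda$, cross with different slopes), and $1/\kappa<\lambda_1<\lambda_2<\cdots$. $\mathcal S$ is the closure in $(0,\infty)\times\mathcal H$ of the set of nontrivial solution pairs, $\mathcal C_1$ is the connected component of $\mathcal S$ containing $(\lambda_1,0)$, and $\mathcal C_1^o$ is the connected component of $\mathcal C_1\cap\big((0,\infty)\times\mathcal K^o\big)$ containing $(\lambda_1,0)$. The fracture point $(\lambda_*,u_* )$ (depending on $\varepsilon$) is the fractured solution pair in $\overline{\mathcal C_1^o}$ with $u_*\in\partial\mathcal K$ and $\lambda_*>1$; set $H_1^*(y)=[1+u_*(y/\lambda_* )]/\lambda_*$ on $[0,\lambda_*]$. This function is strictly monotone with a single zero, at one of the two ends, and is oriented here so that $H_1^*(\lambda_* )=0$. For $\lambda>\lambda_*$ the broken solution $H_b$ (on the first branch, with the inverse stretch vanishing on an entire subinterval) is $$H_b(y)=\begin{cases}H_1^*(y),&y\in[0,\lambda_*],\\0,&y\in(\lambda_*,\lambda].\end{cases}$$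 *)

(* Defs.v *)
From HB Require Import structures.
From mathcomp Require Import all_boot all_order ssralg ssrnum ssrint interval.
From mathcomp Require Import all_classical all_reals all_analysis measurable_realfun.
From mathcomp Require Import ring lra.

Set Implicit Arguments.
Unset Strict Implicit.
Unset Printing Implicit Defensive.
Import Order.TTheory GRing.Theory Num.Theory.
Import numFieldTopology.Exports numFieldNormedType.Exports.

Local Open Scope ring_scope.
Local Open Scope classical_set_scope.

(* An element of H^1(a, b) is identified with its absolutely continuous
   representative; its weak derivative is then the classical derivative u^`(),
   which exists a.e. (u^`() takes a junk value on the remaining null set).  So
   u is in H^1(a, b) iff u^`() is in L^2(a, b) and u is a primitive of it on
   [a, b]. *)
Definition sobolevH1 (R : realType) (a b : R) (u : R -> R) : Prop :=
  (u^`() \_ `]a, b[) \in Lfun (@lebesgue_measure R) 2%:E /\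
  forall x, a <= x <= b ->
    u x = u a + \int[@lebesgue_measure R]_(t in `]a, x[) u^`() t.

(* Functions on [0, 1] are represented by their extension by 0 to the real
   line, so that equality in calH is equality of functions on [0, 1]. *)
Record calH (R : realType) := CalH {
  calH_fun :> R -> R ;
  calH_H1 : sobolevH1 0 1 calH_fun ;
  calH_mean : \int[@lebesgue_measure R]_(s in `[0, 1]) calH_fun s = 0 ;
  calH_out : forall s, ~~ (0 <= s <= 1) -> calH_fun s = 0 }.

HB.instance Definition _ (R : realType) := gen_eqMixin (calH R).
HB.instance Definition _ (R : realType) := gen_choiceMixin (calH R).

(* The distance induced by the inner product <u, v> = \int_0^1 u' v'. *)
Definition calH_dist (R : realType) (u v : calH R) : R :=
  Num.sqrt (\int[@lebesgue_measure R]_(s in `]0, 1[)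
              (u^`() s - v^`() s) ^+ 2).

Section calH_metric.
Context (R : realType).
Local Notation mu := (@lebesgue_measure R).
Implicit Types u v w : calH R.

Lemma calH_ext u v : (u : R -> R) = v -> u = v.
Proof.
case: u v => [u u1 u2 u3] [v v1 v2 v3] /= uv; subst v.
by congr CalH; exact: Prop_irrelevance.
Qed.

Let der u : LfunType mu (lee1n 2) := Lfun_Sub (lee1n 2) (calH_H1 u).1.

Let norm2 (f : LfunType mu (lee1n 2)) := fine ('N[mu]_2%:E[EFin \o f])%E.

Lemma calH_distE u v : calH_dist u v = norm2 (der u - der v).
Proof.
rewrite /calH_dist /norm2 unlock fine_poweR /=.
have -> : (\int[mu]_x (`|(u^`() \_ `]0%R, 1%R[) x - (v^`() \_ `]0%R, 1%R[) x|%:E `^ 2) =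
  \int[mu]_(x in `]0%R, 1%R[) ((u^`() x - v^`() x) ^+ 2)%:E)%E.
  rewrite [RHS]integral_mkcond; apply: eq_integral => x _ /=.
  rewrite !patchE; case: ifPn => _.
    by rewrite (powR_mulrn 2%N)// real_normK// num_real.
  by rewrite subrr normr0 powR0.
by rewrite powR12_sqrt// Rintegral_ge0// => x _; exact: sqr_ge0.
Qed.

Lemma calH_distxx u : calH_dist u u = 0.
Proof.
rewrite /calH_dist; under eq_Rintegral do rewrite subrr expr0n.
by rewrite /Rintegral integral0 sqrtr0.
Qed.

Lemma calH_dist_sym u v : calH_dist u v = calH_dist v u.
Proof.
rewrite /calH_dist (@eq_Rintegral _ _ _ mu _ (fun s => (v^`() s - u^`() s) ^+ 2))//.
by move=> x _; rewrite -sqrrN opprB.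
Qed.

Lemma calH_dist_triangle v u w :
  calH_dist u w <= calH_dist u v + calH_dist v w.
Proof.
rewrite !calH_distE; have -> : der u - der w = (der u - der v) + (der v - der w).
  by rewrite addrA subrK.
exact: ler_LnormD.
Qed.

Let g u : R -> R := u^`() \_ `]0, 1[.

Let g_meas u : measurable_fun setT (g u).
Proof. by have /andP[+ _] := (calH_H1 u).1; rewrite inE. Qed.

Let g_int u : mu.-integrable `[0, 1] (EFin \o g u).
Proof.
apply: (@le_integrable _ _ _ mu _ _ _ (EFin \o (fun x => 1 + g u x ^+ 2))) => //.
- by apply/measurable_EFinP; exact: (measurable_funS _ _ (g_meas u)).
- move=> x _ /=; rewrite lee_fin [leRHS]ger0_norm ?addr_ge0 ?sqr_ge0//.
  by rewrite ler_norml; apply/andP; split; nra.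
- rewrite (_ : _ \o _ = (fun x => (EFin \o cst 1%R) x + (EFin \o (fun x => (g u x ^+ 2)%R)) x)%E); last by [].
  apply: integrableD => //.
    apply: continuous_compact_integrable; first exact: segment_compact.
    by apply: continuous_subspaceT => x; exact: cvg_cst.
  apply: (integrableS measurableT) => //.
  exact: (Lfun2_integrable_sqr (calH_H1 u).1).
Qed.

Let calH_primitive u x : 0 <= x <= 1 ->
  u x = u 0 + \int[mu]_(t in `[0, x]) g u t.
Proof.
move=> x01; rewrite {1}((calH_H1 u).2 x x01); congr (_ + _).
have x1 : x <= 1 by case/andP: x01.
have sub : `[0, x] `<=` `[0, 1].
  by apply: subset_itvl; rewrite bnd_simp.
have gi : mu.-integrable `[0, x] (EFin \o g u) by apply: (integrableS _ _ _ (g_int u)).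
have gi' : mu.-integrable `[0, x[ (EFin \o g u).
  by apply: (integrableS _ _ _ gi) => //; exact: subset_itv_co_cc.
rewrite -(Rintegral_itv_bndo_bndc gi') -Rintegral_itv_obnd_cbnd; last first.
  by apply: (integrableS _ _ _ gi) => //; exact: subset_itv_oo_cc.
apply: eq_Rintegral => t; rewrite inE/= in_itv/= => /andP[t0 tx].
by rewrite /g patchE ifT// inE/= in_itv/= t0 (lt_le_trans tx).
Qed.

Let calH_integrable u : mu.-integrable `[0, 1] (EFin \o u).
Proof.
apply: (@eq_integrable _ _ _ mu _ _ (EFin \o (fun x => u 0 + parameterized_integral mu 0 x (g u)))) => //.
  move=> x; rewrite inE/= in_itv/= => x01.
  by rewrite [in RHS]/= (calH_primitive u x01).
apply: continuous_compact_integrable; first exact: segment_compact.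
move=> x; apply: cvgD; first exact: cvg_cst.
exact: (parameterized_integral_continuous ler01 (g_int u)).
Qed.

Lemma calH_dist_eq0 u v : calH_dist u v = 0 -> u = v.
Proof.
rewrite calH_distE => /fine_Lnormr_eq0 uv; apply: calH_ext.
have gE x : \int[mu]_(t in `[0, x]) g u t = \int[mu]_(t in `[0, x]) g v t.
  rewrite /Rintegral (@ae_eq_integral _ _ _ mu `[0, x] (EFin \o g v) (EFin \o g u))//.
  - by apply/measurable_EFinP; exact: (measurable_funS _ _ (g_meas u)).
  - by apply/measurable_EFinP; exact: (measurable_funS _ _ (g_meas v)).
  - apply: filterS uv => t /= /(_ I) h _; congr EFin.
    by apply/eqP; rewrite -subr_eq0; apply/eqP.
have ce x : 0 <= x <= 1 -> u x = v x + (u 0 - v 0).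
  by move=> x01; rewrite (calH_primitive u x01) gE (calH_primitive v x01); ring.
have c0 : u 0 - v 0 = 0.
  rewrite -[RHS](calH_mean u).
  rewrite (@eq_Rintegral _ _ _ mu _ (fun x => v x + cst (u 0 - v 0) x)); last first.
    by move=> x; rewrite inE/= in_itv/= => /ce.
  rewrite RintegralD//; last first.
    apply: continuous_compact_integrable; first exact: segment_compact.
    by apply: continuous_subspaceT => x; exact: cvg_cst.
  rewrite calH_mean add0r Rintegral_cst//.
  by rewrite [X in _ * fine X]lebesgue_measure_itv/= lte_fin ltr01 -EFinB subr0 mulr1.
apply/funext => x; have [x01|x01] := boolP (0 <= x <= 1).
  by rewrite (ce _ x01) c0 addr0.
by rewrite !calH_out.
Qed.
End calH_metric.

HB.instance Definition _ (R : realType) := @isMetric.Build R (calH R)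
  (@calH_dist R) (@calH_distxx R) (@calH_dist_eq0 R) (@calH_dist_sym R)
  (@calH_dist_triangle R).

Lemma derive1_zero (R : realType) : (cst 0 : R -> R)^`() = cst 0.
Proof. by apply/funext => x; rewrite derive1_cst. Qed.

Lemma calH0_subproof (R : realType) : sobolevH1 0 1 (cst 0 : R -> R).
Proof.
split=> [|x _]; rewrite derive1_zero.
  rewrite (_ : _ \_ _ = cst 0).
    exact: (LfunP (cst 0 : LfunType (@lebesgue_measure R) (lee1n 2))).
  by apply/funext => x; rewrite patchE; case: ifP.
by rewrite /Rintegral integral0 addr0.
Qed.

Definition calH0 (R : realType) : calH R.
Proof.
refine (@CalH R (cst 0) (@calH0_subproof R) _ _) => [|//].
by rewrite /Rintegral integral0.
Defined.

Section stored_energy.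
Context (R : realType).
Implicit Types (W f : R -> R) (gamma kappa H : R) (A : set R).

Definition strictly_convex A f : Prop :=
  forall x y t, A x -> A y -> x != y -> 0 < t < 1 ->
    f (t * x + (1 - t) * y) < t * f x + (1 - t) * f y.

Definition strictly_concave A f : Prop := strictly_convex A (\- f).

(* Only the values of W on (0, +oo) matter. *)
Record stored_energy W gamma kappa : Prop := StoredEnergy {
  kappa_gt0 : 0 < kappa ;
  kappa_lt1 : kappa < 1 ;
  gamma_gt0 : 0 < gamma ;
  W_derivable : forall k x, (k < 3)%N -> 0 < x -> derivable W^`(k) x 1 ;
  W_continuous3 : forall x, 0 < x -> {for x, continuous W^`(3)} ;
  W_cvg0 : W F @[F --> 0^'+] --> +oo ;
  W_mono0 : \forall d \near 0^'+, {in `]0, d[ &, {homo W : x y /~ x <= y}} ;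
  W_cvgy : W F @[F --> +oo] --> gamma ;
  W_monoy : \forall M \near +oo, {in `]M, +oo[ &, {homo W : x y / x <= y}} ;
  W_at1 : W 1 = 0 ;
  W_gt0 : forall F, 0 < F -> F != 1 -> 0 < W F ;
  W_convex : strictly_convex `]0, kappa^-1[ W ;
  W_concave : strictly_concave `]kappa^-1, +oo[ W }.

Definition Wstar W H : \bar R :=
  if H < 0 then +oo%E else if H == 0 then 0%E else (H * W H^-1)%:E.

(* Agrees with Wstar on its effective domain [0, +oo). *)
Definition WstarR W H : R := fine (Wstar W H).

(* The derivative of Wstar on [0, +oo), with the convention
   dWstar 0 = dWstar 0^+ = gamma. *)
Definition dWstar W gamma H : R :=
  if H == 0 then gamma else (WstarR W)^`() H.

(* Roots are indexed from 1 (l 0 is irrelevant); transversality is with respect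
   to the variable mu = 1 / lam. *)
Record characteristic_roots W kappa eps (l : nat -> R) : Prop :=
  CharacteristicRoots {
  root_unique : forall n lam, (0 < n)%N -> 0 < lam ->
    (eps * n%:R ^+ 2 * pi ^+ 2 / lam ^+ 2 = - (WstarR W)^`(2) lam^-1) <->
    lam = l n ;
  root_transversal : forall n, (0 < n)%N ->
    (fun mu => eps * n%:R ^+ 2 * pi ^+ 2 * mu ^+ 2)^`() (l n)^-1 !=
    (fun mu => - (WstarR W)^`(2) mu)^`() (l n)^-1 ;
  root1_gt : kappa^-1 < l 1%N ;
  root_lt : forall n, (0 < n)%N -> l n < l n.+1 }.

End stored_energy.

Section branch.
Context (R : realType).
Implicit Types (W : R -> R) (gamma eps lam : R) (u v : calH R).
Local Notation mu := (@lebesgue_measure R).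

Definition calK : set (calH R) :=
  [set v | forall s, 0 <= s <= 1 -> -1 <= v s].

Definition calKo : set (calH R) :=
  [set v | calK v /\ forall s, 0 <= s <= 1 -> -1 < v s].

Definition bdK : set (calH R) := calK `\` calKo.

Definition solution_pair W gamma eps : set (R * calH R) :=
  [set p | let: (lam, u) := p in [/\ 0 < lam, calK u & forall v, calK v ->
    0 <= \int[mu]_(s in `[0, 1])
      (eps * u^`() s * (v^`() s - u^`() s) +
       lam ^+ 3 * dWstar W gamma ((1 + u s) / lam) * (v s - u s))]].

Definition nontrivial_solutions W gamma eps : set (R * calH R) :=
  [set p | solution_pair W gamma eps p /\ p.2 <> calH0 R].

(* The intersection makes this the closure relative to (0, +oo) x calH. *)
Definition calS W gamma eps : set (R * calH R) :=
  closure (nontrivial_solutions W gamma eps) `&` [set p | 0 < p.1].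

(* lam1 stands for the first characteristic root. *)
Definition calC1 W gamma eps lam1 : set (R * calH R) :=
  connected_component (calS W gamma eps) (lam1, calH0 R).

Definition calC1o W gamma eps lam1 : set (R * calH R) :=
  connected_component
    (calC1 W gamma eps lam1 `&` [set p | 0 < p.1 /\ calKo p.2])
    (lam1, calH0 R).

Definition inverse_stretch lam u (y : R) : R := (1 + u (y / lam)) / lam.

(* The inverse stretch at the fracture point is strictly monotone with a single
   zero, at one end.  The reflection s |-> 1 - s gives two fracture points; the
   last two clauses select the one whose zero is at y = lam, for which the
   (nonnegative) inverse stretch is decreasing. *)
Record fracture_point W gamma eps lam1 lam u : Prop := FracturePoint {
  fracture_closure : closure (calC1o W gamma eps lam1) (lam, u) ;
  fracture_solution : solution_pair W gamma eps (lam, u) ;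
  fracture_bdK : bdK u ;
  fracture_gt1 : 1 < lam ;
  fracture_monotone :
    {in `[0, lam] &, {homo inverse_stretch lam u : x y /~ x < y}} ;
  fracture_zero : inverse_stretch lam u lam = 0 }.

(* To be considered on [0, lam] with lam > lams. *)
Definition broken_solution (lams : R) (us : calH R) (y : R) : R :=
  if y <= lams then inverse_stretch lams us y else 0.

Definition energy W eps lam (H : R -> R) : \bar R :=
  (\int[mu]_(y in `[0%R, lam])
     ((eps / 2 * H^`() y ^+ 2)%:E + Wstar W (H y)))%E.

End branch.

(* Main.v *)
Require Import Defs.
From HB Require Import structures.
From mathcomp Require Import all_boot all_order ssralg ssrnum ssrint interval.
From mathcomp Require Import all_classical all_reals all_analysis measurable_realfun.
From mathcomp Require Import ring lra.

Set Implicit Arguments.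
Unset Strict Implicit.
Unset Printing Implicit Defensive.
Import Order.TTheory GRing.Theory Num.Theory.
Import numFieldTopology.Exports numFieldNormedType.Exports.

Local Open Scope ring_scope.
Local Open Scope classical_set_scope.

(** Let [u] be a fractured solution, [H] its inverse stretch on [[0, lam]], [m] the
    maximum of [H], attained at [y = 0]. Where the constraint is inactive, the
    variational inequality is the equation [Wstar' H - eps H'' = k], [k] being the
    Lagrange multiplier of the mean value constraint. At [y = lam] the profile
    touches [H = 0], tangentially since lifting the end point is admissible while
    [H] is decreasing. As [Wstar 0 = 0], the first integral is therefore
    [eps H'^2 / 2 = Wstar H - k H], without constant ([first_integral]). At [y = 0] it
    gives [k = W (1/m)], and it forces [m <= 1] and [k >= 0].

    The first integral turns the energy into
    [sqrt eps * \int_0^m sqrt (2 (Wstar H - k H)) dH + k], the last term because [H]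
    has integral [1]; the broken part of the bar contributes nothing. As
    [sqrt a - sqrt (a - b) <= sqrt b], replacing [k] by [0] under the square root and
    [m] by [1] costs at most [sqrt (2 k)] ([well_integral_bound]), so everything
    reduces to showing [k = o(sqrt eps)].

    In fact [k <= D eps] ([multiplier_bound]). Indeed
    [1 = \int H dy = sqrt eps * \int_0^m H / sqrt (2 (Wstar H - k H)) dH], and the last
    integral is at most a constant times [k^(-1/2)], provided that the graph of
    [Wstar] keeps away from its chord of slope [k] between [0] and [m]
    ([WstarR_gap]). In terms of [W] this is the growth condition
    [C (W x) <= W' x * x^4] for [x > 1] ([W_growth]). Near [1] it follows from
    convexity. Far out it is a matter of decay of [W''], and concavity alone would not
    do: the profiles could then have [m -> 0] and [k -> gamma]. It is the uniqueness of
    the roots of the characteristic equation that bounds [- W'' x * x^5] away from [0]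
    ([W2_le], [roots_growth]).

    The equation is obtained from the variational inequality by testing with ramps
    [max (x - s) 0]. Their derivatives are step functions, so that the weak
    formulation directly gives [u] as a twice iterated primitive of the stress
    ([ramp_variation_ge0], [u_is_derive]). That [u] plus a combination of ramps belongs
    to [calH] rests on Lebesgue's differentiation theorem and on the Borel
    measurability of the derivative of a continuous function
    ([primitive_sobolevH1], [measurable_derive1]). *)

(** * Derivatives and continuity of pointwise-defined functions *)

Section pointwise_derivatives.
Context {R : realType}.
Implicit Types (f g : R -> R) (x a b : R).

Lemma is_derive1_cst (c x : R) : is_derive x 1 (fun=> c) 0.
Proof. exact: is_derive_cst. Qed.

Lemma is_derive1_id x : is_derive x 1 (fun y : R => y) 1.
Proof. exact: is_derive_id. Qed.

Lemma is_derive1D f g x a b : is_derive x 1 f a -> is_derive x 1 g b ->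
  is_derive x 1 (fun y => f y + g y) (a + b).
Proof. exact: is_deriveD. Qed.

Lemma is_derive1N f x a : is_derive x 1 f a -> is_derive x 1 (fun y => - f y) (- a).
Proof. exact: is_deriveN. Qed.

Lemma is_derive1B f g x a b : is_derive x 1 f a -> is_derive x 1 g b ->
  is_derive x 1 (fun y => f y - g y) (a - b).
Proof. by move=> fa gb; apply: is_derive1D => //; exact: is_derive1N. Qed.

Lemma is_derive1M f g x a b : is_derive x 1 f a -> is_derive x 1 g b ->
  is_derive x 1 (fun y => f y * g y) (a * g x + f x * b).
Proof.
move=> fa gb; apply: (is_derive_eq (is_deriveM fa gb)).
by rewrite /GRing.scale/= addrC mulrC.
Qed.

Lemma is_derive1Z (c : R) f x a : is_derive x 1 f a ->
  is_derive x 1 (fun y => c * f y) (c * a).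
Proof.
move=> fa; apply: (is_derive_eq (is_derive1M (is_derive1_cst c x) fa)).
by rewrite mul0r add0r.
Qed.

Lemma is_derive1X n f x a : is_derive x 1 f a ->
  is_derive x 1 (fun y => f y ^+ n) (n%:R * f x ^+ n.-1 * a).
Proof.
move=> fa; have -> : (fun y => f y ^+ n) = f ^+ n.
  by apply/funext => y; rewrite exprfctE.
exact: is_deriveX.
Qed.

Lemma is_derive1V f x a : f x != 0 -> is_derive x 1 f a ->
  is_derive x 1 (fun y => (f y)^-1) (- a / f x ^+ 2).
Proof.
move=> fx0 fa; have [da Da] := fa.
split; first exact: derivableV.
by rewrite deriveV// Da /GRing.scale/= mulrC mulrN mulNr.
Qed.

Lemma is_derive1_chain f g x a b : is_derive (g x) 1 f a -> is_derive x 1 g b ->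
  is_derive x 1 (fun y => f (g y)) (a * b).
Proof. exact: is_derive1_comp. Qed.

Lemma is_derive1_affine (c d x : R) : is_derive x 1 (fun y => c + y * d) d.
Proof.
apply: (is_derive_eq (is_derive1D (is_derive1_cst c x)
  (is_derive1M (is_derive1_id x) (is_derive1_cst d x)))).
by rewrite add0r mul1r mulr0 addr0.
Qed.

Lemma is_derive1E f x a : is_derive x 1 f a -> f^`() x = a.
Proof. by move=> fa; rewrite derive1E; exact: derive_val. Qed.

Lemma derivable_is_derive f x : derivable f x 1 -> is_derive x 1 f (f^`() x).
Proof. by move=> df; rewrite derive1E; exact/derivableP. Qed.

Lemma is_derive_derivable f x a : is_derive x 1 f a -> derivable f x 1.
Proof. by case. Qed.

Lemma derivable_continuous f x : derivable f x 1 -> {for x, continuous f}.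
Proof. by move=> /derivable1_diffP; exact: differentiable_continuous. Qed.

Lemma is_derive_continuous f x a : is_derive x 1 f a -> {for x, continuous f}.
Proof. by case=> /derivable_continuous. Qed.

Lemma near_eq_is_derive f g x a : (\near x, f x = g x) ->
  is_derive x 1 g a -> is_derive x 1 f a.
Proof.
move=> fg [dg Dg]; have gf : \near x, g x = f x by apply: filterS fg => ? ->.
split; first exact: (near_eq_derivable _ dg).
by rewrite (near_eq_derive _ fg).
Qed.

Lemma is_derive1_cvg_right f x a : is_derive x 1 f a ->
  h^-1 * (f (x + h) - f x) @[h --> 0^'+] --> a.
Proof.
move=> [/cvg_ex[l fl] Df].
have -> : a = l by rewrite -Df /derive; apply/cvg_lim.
move/cvg_dnbhs_at_right : fl.
by under eq_cvg do rewrite /= /GRing.scale/= mulr1 [_ + x]addrC.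
Qed.

Lemma nonincreasing_is_derive_le0 f x b a : is_derive x 1 f a -> x < b ->
  (forall y, x < y < b -> f y <= f x) -> a <= 0.
Proof.
move=> /is_derive1_cvg_right fa xb fx; apply: (cvgr_to_le fa); near=> h.
have h0 : 0 < h by near: h; exact: nbhs_right_gt.
have hb : h < b - x by near: h; apply: nbhs_right_lt; rewrite subr_gt0.
by rewrite pmulr_rle0 ?invr_gt0// subr_le0 fx//; lra.
Unshelve. all: by end_near. Qed.

Lemma ge0_is_derive_le f (df : R -> R) (a b : R) : a <= b ->
  (forall x, a < x < b -> is_derive x 1 f (df x)) ->
  (forall x, a < x < b -> 0 <= df x) ->
  {within `[a, b], continuous f} -> f a <= f b.
Proof.
move=> ab fdf df0 cf; apply: (@ger0_derive1_ndecr _ f a b) => // x.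
  by rewrite in_itv/= => /fdf[].
by rewrite in_itv/= => xab; rewrite (is_derive1E (fdf _ xab)) df0.
Qed.

Lemma MVT_derivable f (a b : R) : a < b ->
  (forall x, a <= x <= b -> derivable f x 1) ->
  exists2 c, a < c < b & f b - f a = f^`() c * (b - a).
Proof.
move=> ab df.
have [x xab||c] := @MVT _ f (f^`()) _ _ ab.
- apply: derivable_is_derive; apply: df.
  by move: xab; rewrite in_itv/= => /andP[/ltW-> /ltW->].
- apply: derivable_within_continuous => y; rewrite in_itv/=; exact: df.
- by rewrite in_itv/= => cab ->; exists c.
Qed.

Lemma is_derive0_within_eq f (a b : R) : a <= b ->
  (forall x, a < x < b -> is_derive x 1 f 0) -> {within `[a, b], continuous f} ->
  f a = f b.
Proof.
move=> ab df cf; apply/eqP; rewrite eq_le; apply/andP; split.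
  exact: (ge0_is_derive_le (df := fun=> 0)).
rewrite -lerN2; apply: (ge0_is_derive_le (f := fun x => - f x) (df := fun=> 0)) => //.
  by move=> x xab; rewrite -[0]oppr0; apply: is_derive1N; exact: df.
by move=> x; apply: cvgN; exact: cf.
Qed.

Lemma within_continuous_comp_continuous (A : set R) f g :
  {within A, continuous f} -> continuous g -> {within A, continuous (fun x => g (f x))}.
Proof. by move=> cf cg x; apply: continuous_comp; [exact: cf|exact: cg]. Qed.

Lemma within_continuous_comp_within (A B : set R) f g :
  {within A, continuous f} -> (forall x, A x -> B (f x)) ->
  {within B, continuous g} -> {within A, continuous (fun x => g (f x))}.
Proof.
move=> /subspace_continuousP cf AB /subspace_continuousP cg.
apply/subspace_continuousP => x Ax.
apply: (@cvg_comp _ _ _ f g _ (within B (nbhs (f x)))); last exact: cg (AB _ Ax).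
move=> V VV; have H : \forall y \near within A (nbhs x), B (f y) -> V (f y).
  exact: (cf x Ax _ VV).
have HA : \forall y \near within A (nbhs x), A y by rewrite near_withinE; near=> y.
suff : \forall y \near within A (nbhs x), V (f y) by [].
near=> y; have Ay : A y by near: y.
by move: (AB _ Ay); near: y.
Unshelve. all: by end_near. Qed.

End pointwise_derivatives.

(** * The stored energy densities [W] and [Wstar] *)

Section tangents.
Context {R : realType}.
Implicit Types (f : R -> R) (A : set R).

(** The convexity inequality in the limit where the intermediate point tends to [x]. *)
Lemma strictly_convex_tangent A f (x y : R) :
  strictly_convex A f -> A x -> A y -> derivable f x 1 ->
  f^`() x * (y - x) <= f y - f x.
Proof.
move=> cf Ax Ay df; have [->|xy] := eqVneq x y; first by rewrite !subrr mulr0.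
pose k (t : R) := f (x + t * (y - x)).
have dk : is_derive (0 : R) 1 k (f^`() x * (y - x)).
  apply: is_derive1_chain; last exact: is_derive1_affine.
  by rewrite mul0r addr0; exact: derivable_is_derive.
have cvk := is_derive1_cvg_right dk.
apply: (cvgr_to_le cvk); near=> h.
have h0 : 0 < h by near: h; exact: nbhs_right_gt.
have h1 : h < 1 by near: h; exact: nbhs_right_lt.
have := cf y x h Ay Ax; rewrite eq_sym xy h0 h1 => /(_ isT isT)/ltW.
have -> : h * y + (1 - h) * x = x + h * (y - x) by ring.
rewrite /k add0r mul0r addr0 ler_pdivrMl// => H.
by move: H; lra.
Unshelve. all: by end_near. Qed.

End tangents.

Section energy_density.
Context {R : realType} (W : R -> R) (gamma kappa : R).
Hypothesis hW : stored_energy W gamma kappa.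
Implicit Types x y F H : R.

Let kappa_gt0 : 0 < kappa. Proof. by case: hW. Qed.

Let invkappa_gt1 : 1 < kappa^-1.
Proof. by rewrite invf_gt1 ?(kappa_lt1 hW)// kappa_gt0. Qed.

Let gt0_of_gt x : kappa^-1 < x -> 0 < x.
Proof. by move=> kx; have := invkappa_gt1; lra. Qed.

Lemma W_is_derive x : 0 < x -> is_derive x 1 W (W^`() x).
Proof. by move=> x0; apply: derivable_is_derive; exact: (W_derivable hW (k := 0)). Qed.

Lemma W_is_derive2 x : 0 < x -> is_derive x 1 W^`() (W^`(2) x).
Proof. by move=> x0; apply: derivable_is_derive; exact: (W_derivable hW (k := 1)). Qed.

Lemma W2_continuous x : 0 < x -> {for x, continuous W^`(2)}.
Proof. by move=> x0; apply: derivable_continuous; exact: (W_derivable hW (k := 2)). Qed.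

Lemma W_ge0 x : 0 < x -> 0 <= W x.
Proof.
move=> x0; have [->|x1] := eqVneq x 1; first by rewrite (W_at1 hW).
exact/ltW/(W_gt0 hW).
Qed.

Lemma WstarR_gt0E H : 0 < H -> WstarR W H = H * W H^-1.
Proof. by move=> H0; rewrite /WstarR /Wstar ltNge ltW//= gt_eqF. Qed.

Lemma WstarR0 : WstarR W 0 = 0.
Proof. by rewrite /WstarR /Wstar ltxx eqxx. Qed.

Lemma WstarR_is_derive H : 0 < H ->
  is_derive H 1 (WstarR W) (W H^-1 - W^`() H^-1 / H).
Proof.
move=> H0; apply: (@near_eq_is_derive _ _ (fun H => H * W H^-1)).
  by near do (apply: WstarR_gt0E); exact: lt_nbhsr.
have dV := is_derive1V (lt0r_neq0 H0) (is_derive1_id H).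
have dW : is_derive H^-1 1 W (W^`() H^-1) by apply: W_is_derive; rewrite invr_gt0.
apply: (is_derive_eq (is_derive1M (is_derive1_id H) (is_derive1_chain dW dV))).
by field; rewrite gt_eqF.
Unshelve. all: by end_near. Qed.

Lemma WstarR_is_derive2 H : 0 < H ->
  is_derive H 1 (WstarR W)^`() (W^`(2) H^-1 / H ^+ 3).
Proof.
move=> H0; apply: (@near_eq_is_derive _ _ (fun H => W H^-1 - W^`() H^-1 * H^-1)).
  near=> x; apply: is_derive1E; apply: WstarR_is_derive.
  by near: x; exact: lt_nbhsr.
have dV := is_derive1V (lt0r_neq0 H0) (is_derive1_id H).
have dW : is_derive H^-1 1 W (W^`() H^-1) by apply: W_is_derive; rewrite invr_gt0.
have dW' : is_derive H^-1 1 W^`() (W^`(2) H^-1) by apply: W_is_derive2; rewrite invr_gt0.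
apply: (is_derive_eq (is_derive1B (is_derive1_chain dW dV)
  (is_derive1M (is_derive1_chain dW' dV) dV))).
by field; rewrite gt_eqF.
Unshelve. all: by end_near. Qed.

Lemma WstarR_derive_continuous H : 0 < H -> {for H, continuous (WstarR W)^`()}.
Proof. by move=> H0; exact: (is_derive_continuous (WstarR_is_derive2 H0)). Qed.

(** On the convex part, the tangent at [x] passes below the minimum at [1]. *)
Lemma W_le_slope x : 1 < x < kappa^-1 -> W x <= W^`() x * (x - 1).
Proof.
move=> /andP[x1 xk]; have x0 : 0 < x by lra.
have := strictly_convex_tangent (W_convex hW) (x := x) (y := 1).
rewrite /= !in_itv/= x0 xk ltr01 invkappa_gt1 => /(_ isT isT).
move=> /(_ (is_derive_derivable (W_is_derive x0))).
by rewrite (W_at1 hW); lra.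
Qed.

Lemma W_concave_tangent x y : kappa^-1 < x -> kappa^-1 < y ->
  W y - W x <= W^`() x * (y - x).
Proof.
move=> kx ky; have x0 := gt0_of_gt kx.
have dN := is_derive1N (W_is_derive x0).
have := strictly_convex_tangent (W_concave hW) (x := x) (y := y).
rewrite /= !in_itv/= kx ky => /(_ isT isT (is_derive_derivable dN)).
by rewrite (is_derive1E dN); lra.
Qed.

(** A concave function that is bounded below on a half line is nondecreasing. *)
Lemma W1_ge0 x : kappa^-1 < x -> 0 <= W^`() x.
Proof.
move=> kx; rewrite leNgt; apply/negP => dW0.
have x0 := gt0_of_gt kx.
have Wx := W_ge0 x0.
have [y [xy Ey]] : exists y, x < y /\ W^`() x * (y - x) = - (W x + 1).
  exists (x + (W x + 1) / - W^`() x); split; last by field; lra.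
  by rewrite ltrDl divr_gt0//; lra.
have := W_concave_tangent kx (lt_trans kx xy); rewrite Ey.
have y0 : 0 < y by lra.
by have := W_ge0 y0; lra.
Qed.

Lemma W1_nonincreasing x y : kappa^-1 < x -> x <= y -> W^`() y <= W^`() x.
Proof.
move=> kx; rewrite le_eqVlt => /predU1P[->//|xy].
have ky := lt_trans kx xy.
have t1 := W_concave_tangent kx ky; have t2 := W_concave_tangent ky kx.
by rewrite -(ler_pM2r (x := y - x)) ?subr_gt0//; lra.
Qed.


(** Beyond any point [F1] at which [- W'' F^5] takes the value [c] for the only
    time, that quantity stays above [c]: it is nonpositive somewhere to the left
    of [F1], so by the intermediate value theorem it takes every value in
    [(0, c)] before [F1] and could not return to such a value after [F1] without
    contradicting uniqueness. *)
Lemma W2_le c F1 : 0 < c -> kappa^-1 < F1 -> - W^`(2) F1 * F1 ^+ 5 = c ->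
  (forall v x y, 0 < v -> 0 < x -> 0 < y ->
    - W^`(2) x * x ^+ 5 = v -> - W^`(2) y * y ^+ 5 = v -> x = y) ->
  forall x, F1 < x -> W^`(2) x <= - c / x ^+ 5.
Proof.
move=> c0 kF1 QF1 Qinj x F1x.
pose Q y := - W^`(2) y * y ^+ 5; have QF1' : Q F1 = c := QF1.
have x0 : 0 < x by have := gt0_of_gt kF1; lra.
have Qcont y : 0 < y -> {for y, continuous Q}.
  move=> y0; apply: cvgM; first by apply: cvgN; exact: W2_continuous.
  exact: exprn_continuous.
have Qwithin a b : 0 < a -> {within `[a, b], continuous Q}.
  move=> a0; apply: continuous_in_subspaceT => y; rewrite inE/= in_itv/= => /andP[ay _].
  by apply: Qcont; lra.
suff Qx : c <= Q x.
  by rewrite ler_pdivlMr ?exprn_gt0//; rewrite /Q in Qx; lra.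
rewrite leNgt; apply/negP => Qxc.
(* The derivative of a convex function is nondecreasing, so [W''] is nonnegative
   somewhere in [(1, 1/kappa)]. *)
have [z /andP[z1 zk] Qz] : exists2 z, 1 < z < kappa^-1 & Q z <= 0.
  have := invkappa_gt1; set K := kappa^-1 => K1.
  pose d := (1 + K) / 2.
  have d1 : 1 < d by rewrite /d; lra.
  have [|z zd Dz] := MVT_derivable (f := W^`()) d1.
    by move=> y y1; apply: is_derive_derivable (W_is_derive2 _); lra.
  exists z; first by move: zd; rewrite /d; lra.
  rewrite /Q mulNr oppr_le0 mulr_ge0 ?exprn_ge0//; last by lra.
  have t1 := strictly_convex_tangent (W_convex hW) (x := 1) (y := d).
  have t2 := strictly_convex_tangent (W_convex hW) (x := d) (y := 1).
  have d0 : 0 < d by lra.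
  have dK : d < K by rewrite /d; lra.
  move: t1 t2; rewrite /= !in_itv/= ltr01 K1 d0 dK /=.
  move=> /(_ isT isT (is_derive_derivable (W_is_derive ltr01))) t1.
  move=> /(_ isT isT (is_derive_derivable (W_is_derive d0))) t2.
  by rewrite -(pmulr_lge0 (x := d - 1)) ?subr_gt0//; nra.
(* A positive level that [Q] crosses both before [F1] and between [F1] and [x]. *)
pose v := (Num.max (Q x) 0 + c) / 2.
have [v0 vx vc] : [/\ 0 < v, Q x < v & v < c].
  by rewrite /v; split; case: (lerP (Q x) 0); lra.
have zF1 : z < F1 by lra.
have z0 : 0 < z by lra.
have F10 : 0 < F1 by lra.
have [|x1] := IVT (ltW zF1) (Qwithin z F1 z0) (v := v).
  rewrite QF1' ge_min le_max; apply/andP; split; apply/orP; [left|right]; lra.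
rewrite in_itv/= => x1F Qx1.
have [|x2] := IVT (ltW F1x) (Qwithin F1 x F10) (v := v).
  rewrite QF1' ge_min le_max; apply/andP; split; apply/orP; [right|left]; lra.
rewrite in_itv/= => x2F Qx2.
have x12 : x1 = x2 by apply: (Qinj v) => //; lra.
by have x1E : x1 = F1 by [lra]; move: Qx1; rewrite x1E; lra.
Qed.

End energy_density.
Section energy_growth.
Context {R : realType} (W : R -> R) (gamma kappa : R).
Hypothesis hW : stored_energy W gamma kappa.
Implicit Types x y F H m : R.

Let invkappa_gt1 : 1 < kappa^-1.
Proof. by rewrite invf_gt1 ?(kappa_lt1 hW)// (kappa_gt0 hW). Qed.

Let W1_continuous x : 0 < x -> {for x, continuous W^`()}.
Proof. by move=> x0; exact: is_derive_continuous (W_is_derive2 hW x0). Qed.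

Let W1_nonincreasing_closed x y : kappa^-1 <= x -> x < y -> W^`() y <= W^`() x.
Proof.
move=> kx xy; have x0 : 0 < x by have := invkappa_gt1; lra.
apply: (@cvgr_to_ge _ (x^'+) _ _ W^`()).
  exact: cvg_at_right_filter (W1_continuous x0).
near=> z; apply: (W1_nonincreasing hW).
  by rewrite (le_lt_trans kx)//; near: z; exact: nbhs_right_gt.
by near: z; exact: nbhs_right_le.
Unshelve. all: by end_near. Qed.

Let W1_ge0_gt1 x : 1 < x -> 0 <= W^`() x.
Proof.
move=> x1; have [xk|kx] := ltP x kappa^-1; last first.
  apply: le_trans (@W1_nonincreasing_closed x (x + 1) kx _); last by rewrite ltrDl.
  by apply: (W1_ge0 hW); lra.
have := @W_le_slope _ _ _ _ hW x; rewrite x1 xk => /(_ isT).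
have : 0 <= W x by apply: (W_ge0 hW); lra.
by move=> W0 /(le_trans W0); rewrite pmulr_lge0// subr_gt0.
Qed.

Lemma W_nondecreasing x y : 1 <= x -> x <= y -> W x <= W y.
Proof.
move=> x1 xy; apply: (ge0_is_derive_le (df := W^`())) => //.
- by move=> z zxy; apply: (W_is_derive hW); lra.
- by move=> z zxy; apply: W1_ge0_gt1; lra.
- apply: continuous_in_subspaceT => z; rewrite inE/= in_itv/= => /andP[xz _].
  by apply: is_derive_continuous (W_is_derive hW _); lra.
Qed.

Lemma W_le_gamma x : 1 <= x -> W x <= gamma.
Proof.
move=> x1; apply: (cvgr_to_ge (W_cvgy hW)); near=> y.
by apply: W_nondecreasing => //; near: y; exact: nbhs_pinfty_ge.
Unshelve. all: by end_near. Qed.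

(** [W' - c x^-4 / 4] is nonincreasing; were it negative at some point, [W'] would
    become negative far out, where [x^-4] is negligible. *)
Lemma W1_lower c F1 : 0 < c -> kappa^-1 < F1 ->
  (forall x, F1 < x -> W^`(2) x <= - c / x ^+ 5) ->
  forall x, F1 < x -> c / 4 / x ^+ 4 <= W^`() x.
Proof.
move=> c0 kF1 W2c x F1x; rewrite leNgt; apply/negP => Wx.
have x0 : 0 < x by have := invkappa_gt1; lra.
pose psi y := W^`() y - c / 4 * (y ^+ 4)^-1.
have dpsi y : F1 < y -> is_derive y 1 psi (W^`(2) y + c / y ^+ 5).
  move=> F1y; have y0 : 0 < y by have := invkappa_gt1; lra.
  have y4 : y ^+ 4 != 0 by rewrite expf_neq0// gt_eqF.
  apply: (is_derive_eq (is_derive1B (W_is_derive2 hW y0)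
    (is_derive1Z (c / 4) (is_derive1V (f := fun y => y ^+ 4) y4 (is_derive1X 4 (is_derive1_id y)))))).
  by rewrite /=; field; rewrite gt_eqF.
set e := c / 4 / x ^+ 4 - W^`() x; have e0 : 0 < e by rewrite /e subr_gt0.
have [y [xy y1]] : exists y, x < y /\ c / 4 / e < y.
  exists (x + c / 4 / e); split; last by rewrite ltrDr.
  by rewrite ltrDl !divr_gt0.
have yg1 : 1 < y by have := invkappa_gt1; lra.
have : psi y <= psi x.
  rewrite -lerN2; apply: (ge0_is_derive_le (f := fun y => - psi y) (ltW xy)).
  - by move=> z /andP[xz _]; apply: is_derive1N; apply: dpsi; lra.
  - move=> z /andP[xz _]; have := W2c z; rewrite mulNr.
    by move=> /(_ (lt_trans F1x xz)); lra.
  - apply: continuous_in_subspaceT => z; rewrite inE/= in_itv/= => /andP[xz _].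
    by apply: is_derive_continuous (is_derive1N (dpsi _ _)); lra.
have -> : psi x = - e by rewrite /psi /e opprB.
have y4 : c / 4 * (y ^+ 4)^-1 < e.
  rewrite ltr_pdivrMr ?exprn_gt0//; last by lra.
  rewrite ltr_pdivrMr// in y1; have {}yg1 := ltW yg1.
  apply: lt_le_trans y1 _; rewrite mulrC ler_pM2l// -{1}(expr1 y).
  by rewrite ler_weXn2l.
by have := W1_ge0_gt1 yg1; rewrite /psi; lra.
Qed.

(** Three regimes: on the convex part the slope from the well dominates, far out
    the bound on [W''] integrates to [W' >= c x^-4 / 4], and in between [W'] is
    nonincreasing, hence at least its value slightly further to the right. A
    faster decay of [W'] could leave the integral of [H / sqrt (2 (Wstar H - k H))]
    over [[0, m]] unbounded as [m] tends to [0]. *)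
Lemma W_growth c F1 : 0 < c -> kappa^-1 < F1 ->
  (forall x, F1 < x -> W^`(2) x <= - c / x ^+ 5) ->
  exists2 C, 0 < C & forall x, 1 < x -> C * W x <= W^`() x * x ^+ 4.
Proof.
move=> c0 kF1 W2c; have K1 : 1 < kappa^-1 := invkappa_gt1.
have W1c := W1_lower c0 kF1 W2c.
have g0 := gamma_gt0 hW; have k0 := kappa_gt0 hW.
pose d := W^`() (F1 + 1).
have d0 : 0 < d.
  apply: lt_le_trans (W1c (F1 + 1) _); last by rewrite ltrDl.
  by rewrite !divr_gt0// exprn_gt0//; lra.
exists (Num.min (c / 4 / gamma) (Num.min kappa (d / gamma))).
  by rewrite !lt_min k0 !divr_gt0.
move=> x x1.
set C := Num.min _ _; have [C1 C2 C3] : [/\ C * gamma <= c / 4, C <= kappa & C * gamma <= d].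
  by rewrite -!ler_pdivlMr// /C !ge_min !lexx ?orbT.
have C0 : 0 < C by rewrite !lt_min k0 !divr_gt0.
have x0 : 0 < x by lra.
have W0 := W_ge0 hW x0; have Wg := W_le_gamma (ltW x1).
have x4 : 1 <= x ^+ 4 by rewrite exprn_ege1// ltW.
have CW : C * W x <= C * gamma by rewrite ler_pM2l.
have W1x := W1_ge0_gt1 x1.
have [xk|kx] := ltP x kappa^-1.
  have := @W_le_slope _ _ _ _ hW x; rewrite x1 xk => /(_ isT) sl.
  apply: (@le_trans _ _ (W^`() x)); last by rewrite ler_peMr.
  have kx : kappa * (x - 1) <= 1.
    by rewrite -ler_pdivlMl// mulr1; lra.
  apply: (@le_trans _ _ (kappa * (W^`() x * (x - 1)))); last by nra.
  by rewrite ler_pM// ltW.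
have [xF|Fx] := leP x F1.
  have dx : d <= W^`() x by apply: W1_nonincreasing_closed; lra.
  by apply: (@le_trans _ _ (W^`() x)); [lra|rewrite ler_peMr].
have := W1c x Fx; rewrite ler_pdivrMr ?exprn_gt0//; lra.
Qed.

(** [W + C (W a) x^-3 / 3] is nondecreasing on [[a, +oo)] because [W a <= W x]. *)
Lemma W_gap C : 0 < C -> (forall x, 1 < x -> C * W x <= W^`() x * x ^+ 4) ->
  forall a x, 1 < a -> a <= x ->
    C * W a / 3 * ((a ^+ 3)^-1 - (x ^+ 3)^-1) <= W x - W a.
Proof.
move=> C0 WC a x a1 ax.
pose f y := W y + C * W a / 3 * (y ^+ 3)^-1.
have df y : a <= y -> is_derive y 1 f (W^`() y - C * W a / y ^+ 4).
  move=> ay; have y0 : 0 < y by lra.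
  have y3 : y ^+ 3 != 0 by rewrite expf_neq0// gt_eqF.
  apply: (is_derive_eq (is_derive1D (W_is_derive hW y0)
    (is_derive1Z (C * W a / 3) (is_derive1V (f := fun y => y ^+ 3) y3 (is_derive1X 3 (is_derive1_id y)))))).
  by rewrite /=; field; rewrite gt_eqF.
suff : f a <= f x by rewrite /f; lra.
apply: (ge0_is_derive_le ax (df := fun y => W^`() y - C * W a / y ^+ 4)).
- by move=> y /andP[/ltW ay _]; exact: df.
- move=> y /andP[ay _]; rewrite subr_ge0 ler_pdivrMr ?exprn_gt0//; last by lra.
  apply: le_trans (WC y _); last by lra.
  by rewrite ler_pM2l//; apply: W_nondecreasing; lra.
- apply: continuous_in_subspaceT => y; rewrite inE/= in_itv/= => /andP[ay _].
  exact: is_derive_continuous (df _ ay).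
Qed.

(** In terms of [Wstar], the chord from the origin to the point of abscissa [m]
    lies well below the graph; [W m^-1] is the slope of that chord. *)
Lemma WstarR_gap C : 0 < C -> (forall x, 1 < x -> C * W x <= W^`() x * x ^+ 4) ->
  forall m h, 0 < h -> h <= m -> m < 1 ->
    C / 3 * W m^-1 * m * h ^+ 2 * (m - h) <= WstarR W h - W m^-1 * h.
Proof.
move=> C0 WC m h h0 hm m1; have m0 := lt_le_trans h0 hm.
have a1 : 1 < m^-1 by rewrite invf_gt1.
have ax : m^-1 <= h^-1 by rewrite lef_pV2 ?posrE.
have := W_gap C0 WC a1 ax; rewrite -!exprVn !invrK (WstarR_gt0E _ h0).
have : 0 <= W m^-1 by apply: (W_ge0 hW); rewrite invr_gt0.
set w := W _ => w0 gap.
apply: (@le_trans _ _ (h * (C * w / 3 * (m ^+ 3 - h ^+ 3)))); last by nra.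
have -> : C / 3 * w * m * h ^+ 2 * (m - h) = (C * w / 3) * h * (m * h * (m - h)) by ring.
have -> : h * (C * w / 3 * (m ^+ 3 - h ^+ 3)) = (C * w / 3) * h * (m ^+ 3 - h ^+ 3) by ring.
apply: ler_wpM2l; first by rewrite !mulr_ge0// ltW.
have -> : m ^+ 3 - h ^+ 3 = (m ^+ 2 + m * h + h ^+ 2) * (m - h) by ring.
by rewrite ler_wpM2r ?subr_ge0//; nra.
Qed.

Lemma WstarR_ge0 H : 0 <= H -> 0 <= WstarR W H.
Proof.
rewrite le_eqVlt => /predU1P[<-|H0]; first by rewrite WstarR0.
by rewrite WstarR_gt0E// mulr_ge0 ?(ltW H0)// (W_ge0 hW)// invr_gt0.
Qed.

Lemma WstarR_le H : 0 <= H <= 1 -> WstarR W H <= gamma * H.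
Proof.
rewrite le_eqVlt => /andP[/predU1P[<-|H0] H1]; first by rewrite WstarR0 mulr0.
by rewrite WstarR_gt0E// mulrC ler_pM2r// W_le_gamma// invf_ge1.
Qed.

Lemma WstarR_continuous : continuous (WstarR W).
Proof.
move=> H; have [H0|H0|->] := ltgtP H 0.
- apply: (@is_derive_continuous _ _ _ 0).
  apply: (@near_eq_is_derive _ _ (fun=> 0)).
  near=> x; rewrite /WstarR /Wstar ifT//.
  by near: x; exact: lt_nbhsl.
- exact: is_derive_continuous (WstarR_is_derive hW H0).
- rewrite /continuous_at WstarR0; apply/cvgr0Pnorm_le => e e0; near=> x.
  have [x0|x0] := ltP x 0.
    by rewrite /WstarR /Wstar x0 /= normr0 ltW.
  have x1 : x <= e / gamma.
    near: x; apply: lt_le_nbhsl.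
    by rewrite divr_gt0// (gamma_gt0 hW).
  have x2 : x <= 1 by near: x; exact: lt_le_nbhsl.
  rewrite ger0_norm ?WstarR_ge0//; apply: le_trans (WstarR_le _) _.
    by rewrite x0.
  by rewrite mulrC -ler_pdivlMr// (gamma_gt0 hW).
Unshelve. all: by end_near. Qed.

(** As [H] tends to [0], [dWstar H = W F - F W' F] with [F = 1 / H]; concavity
    bounds [F W' F] by the total increment of [W]. *)
Lemma dWstar_bounded m : exists M, forall H, 0 < H <= m -> `|dWstar W gamma H| <= M.
Proof.
have K1 : 1 < kappa^-1 := invkappa_gt1.
pose p := kappa^-1 + 1.
have p0 : 0 < p by have := invkappa_gt1; rewrite /p; lra.
have W1p : 0 <= W^`() p by apply: (W1_ge0 hW); rewrite /p; lra.
have g0 := gamma_gt0 hW.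
pose b := Num.max m p^-1.
have cw : {within `[p^-1, b], continuous (fun H => `|dWstar W gamma H|)}.
  apply: continuous_in_subspaceT => H; rewrite inE/= in_itv/= => /andP[pH _].
  have H0 : 0 < H by rewrite (lt_le_trans _ pH)// invr_gt0.
  have dE : \near H, dWstar W gamma H = (WstarR W)^`() H.
    by near=> x; rewrite /dWstar gt_eqF//; near: x; exact: lt_nbhsr.
  apply: (@cvg_comp _ _ _ _ (fun x : R => `|x|) _ (nbhs (dWstar W gamma H))).
    rewrite (nbhs_singleton dE).
    apply: cvg_trans (WstarR_derive_continuous hW H0).
    by apply: near_eq_cvg; apply: filterS dE => x ->.
  exact: norm_continuous.
have pb : p^-1 <= b by rewrite /b le_max lexx orbT.
have [c _ cmax] := EVT_max pb cw.
exists (Num.max `|dWstar W gamma c| (2 * gamma + p * W^`() p)) => H /andP[H0 Hm].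
rewrite le_max; have [pH|Hp] := leP p^-1 H.
  by apply/orP; left; apply: cmax; rewrite in_itv/= pH /b le_max Hm.
apply/orP; right.
rewrite /dWstar gt_eqF// (is_derive1E (WstarR_is_derive hW H0)).
set F := H^-1; have pF : p < F by rewrite /F -[p]invrK ltf_pV2// posrE invr_gt0.
have F1 : 1 <= F by have := invkappa_gt1; move: pF; rewrite /p; lra.
have WF := W_le_gamma F1; have WF0 : 0 <= W F by apply: (W_ge0 hW); lra.
have W1F : 0 <= W^`() F by apply: (W1_ge0 hW); move: pF; rewrite /p; lra.
have t : W p - W F <= W^`() F * (p - F).
  by apply: (W_concave_tangent hW); move: pF; rewrite /p; lra.
have Wp0 : 0 <= W p by apply: (W_ge0 hW).
have W1pF : W^`() F <= W^`() p.
  by apply: (W1_nonincreasing hW) (ltW pF); rewrite /p; lra.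
by rewrite ler_norml; apply/andP; split; nra.
Unshelve. all: by end_near. Qed.

End energy_growth.
(** * Borel measurability of the derivative of a continuous function *)

Section measurable_derivative.
Context {R : realType}.
Local Notation mu := (@lebesgue_measure R).

Let quotient (w : R -> R) x h := h^-1 * (w (h + x) - w x).

Let derivable_cvg (w : R -> R) (x : R) : derivable w x 1 <-> cvg (quotient w x h @[h --> 0^']).
Proof.
by rewrite /derivable /quotient; under eq_fun do rewrite /= /GRing.scale/= mulr1.
Qed.

(** By the Cauchy criterion the differentiability set is the intersection over
    [k] of the union over [n] of the sets of points at which the difference
    quotients with increments below [1/n] agree up to [1/k]; for a continuous
    function these sets are closed. *)
Lemma derivable_set_measurable (w : R -> R) : continuous w ->
  measurable [set x | derivable w x 1].
Proof.
move=> cw.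
pose C (k n : nat) := \bigcap_(hh in [set hh : R * R | (0 < `|hh.1| < n.+1%:R^-1)
    /\ (0 < `|hh.2| < n.+1%:R^-1)])
  [set x | `|quotient w x hh.1 - quotient w x hh.2| <= k.+1%:R^-1].
have mC k n : measurable (C k n).
  apply: closed_measurable; apply: closed_bigI => -[h h'] _ /=.
  rewrite (_ : [set _ | _] =
    (fun x => `|quotient w x h - quotient w x h'|) @^-1` [set r | r <= k.+1%:R^-1])//.
  apply: closed_comp => [x _|]; last exact: closed_le.
  have cq t : {for x, continuous (fun x => quotient w x t)}.
    apply: cvgM; first exact: cvg_cst.
    apply: cvgB; last exact: cw.
    apply: (@cvg_comp _ _ _ (fun x => t + x) w _ (nbhs (t + x))); last exact: cw.
    by apply: cvgD; [exact: cvg_cst|exact: cvg_id].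
  apply: (@cvg_comp _ _ _ _ (fun x : R => `|x|) _
    (nbhs (quotient w x h - quotient w x h'))); last exact: norm_continuous.
  by apply: cvgB; exact: cq.
rewrite (_ : [set _ | _] = \bigcap_k \bigcup_n C k n).
  by apply: bigcapT_measurable => k; exact: bigcupT_measurable.
apply/seteqP; split => x /=.
  move=> /derivable_cvg /cvg_ex[/= l]; move=> ql k _.
  have e0 : 0 < (k.+1%:R^-1 / 2 : R) by rewrite divr_gt0// invr_gt0 ltr0n.
  move/cvgrPdist_le : ql => /(_ _ e0); rewrite /dnbhs.
  rewrite near_withinE => /nbhs_ballP[d /= d0 dq].
  have [n _ nd] : exists2 n : nat, True & (n.+1%:R^-1 : R) <= d.
    by have [n] := ltr_add_invr d0; rewrite add0r => /ltW; exists n.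
  exists n => // -[h h'] /= [/andP[h0 hn] /andP[h'0 h'n]].
  have H t : 0 < `|t| -> `|t| < n.+1%:R^-1 -> `|l - quotient w x t| <= k.+1%:R^-1 / 2.
    move=> t0 tn; apply: dq; last by rewrite -normr_gt0.
    by rewrite /ball/= sub0r normrN (lt_le_trans tn).
  move: (H _ h0 hn) (H _ h'0 h'n) => H1 H2; rewrite /=.
  have -> : quotient w x h - quotient w x h' =
    (l - quotient w x h') - (l - quotient w x h) by ring.
  apply: le_trans (ler_normB _ _) _; rewrite [leRHS](splitr k.+1%:R^-1).
  exact: lerD.
move=> Dx; apply/derivable_cvg; apply: cauchy_cvg; apply: cauchy_exP => e e0.
have [k] := ltr_add_invr e0; rewrite add0r => ke.
have [n _ Cn] := Dx k I.
exists (quotient w x (n.+1%:R^-1 / 2)).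
suff : \forall h \near (0 : R)^', ball (quotient w x (n.+1%:R^-1 / 2)) e (quotient w x h).
  by [].
rewrite /dnbhs near_withinE; apply/nbhs_ballP; exists n.+1%:R^-1 => /=; first by rewrite invr_gt0 ltr0n.
move=> h; rewrite /ball/= sub0r normrN => hn h0.
apply: le_lt_trans ke; apply: (Cn (n.+1%:R^-1 / 2, h)) => /=.
have n0 : 0 < (n.+1%:R^-1 : R) by rewrite invr_gt0 ltr0n.
split; last by rewrite hn andbT normr_gt0.
rewrite gtr0_norm ?divr_gt0//=.
by rewrite ltr_pdivrMr// ltr_pMr// ltr1n.
Qed.

(** Off the differentiability set [w^`()] is a constant default value, and on it
    the limit of the quotients [n (w (x + 1/n) - w x)]. *)
Lemma measurable_derive1 (w : R -> R) : continuous w -> measurable_fun setT w^`().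
Proof.
move=> cw; have mD := derivable_set_measurable cw.
set D := [set x | _] in mD.
rewrite -(setUv D); apply/measurable_funU; [exact: mD|exact: measurableC|split].
  apply: (@measurable_fun_cvg _ _ _ _ (fun n x => quotient w x n.+1%:R^-1)).
    move=> n; apply: measurable_funTS; apply: measurable_funM => //.
    apply: measurable_funB; last exact: continuous_measurable_fun.
    apply: (@measurableT_comp _ _ _ _ _ _ w); first exact: continuous_measurable_fun.
    exact: measurable_funD.
  move=> x /derivable_cvg; rewrite derive1E => cq.
  have -> : 'D_1 w x = lim (quotient w x h @[h --> 0^']).
    by rewrite /derive /quotient; under eq_fun do rewrite /= /GRing.scale/= mulr1.
  move/cvg_dnbhs_at_right/cvg_at_rightP : cq; apply; split=> [n|].
    by rewrite invr_gt0 ltr0n.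
  exact: cvg_harmonic.
apply: (@eq_measurable_fun _ _ _ _ _ (cst point)); last exact: measurable_cst.
move=> x; rewrite inE => /= nD.
have -> : w^`() x = lim (quotient w x h @[h --> 0^']) by [].
have nq : ~ cvg (quotient w x h @[h --> 0^']) by move=> cq; exact: nD ((derivable_cvg w x).2 cq).
by rewrite (dvgP nq).
Qed.

End measurable_derivative.
(** * Primitives of square integrable functions *)

Section sobolev.
Context {R : realType}.
Local Notation mu := (@lebesgue_measure R).
Implicit Types (w d : R -> R).

Lemma Lfun2_integrable01 d : d \_ `]0, 1[ \in Lfun mu 2%:E ->
  mu.-integrable setT (EFin \o (d \_ `]0, 1[)).
Proof.
move=> d2; have /andP[+ _] := d2; rewrite inE => md.
suff : mu.-integrable `]0, 1[ (EFin \o (d \_ `]0, 1[)).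
  move=> fi; rewrite -restrict_EFin; apply/integrable_restrict => //; rewrite setTI.
  apply: (@eq_integrable _ _ _ mu _ _ _ _ _ fi) => // x x01 /=; rewrite patchE x01//.
apply: (@le_integrable _ _ _ mu _ _ _
  (EFin \o (fun x => 1 + (d \_ `]0, 1[) x ^+ 2))) => //.
- by apply/measurable_EFinP; exact: (measurable_funS _ _ md).
- move=> x _ /=; rewrite lee_fin [leRHS]ger0_norm ?addr_ge0 ?sqr_ge0//.
  by rewrite ler_norml; apply/andP; split; nra.
- rewrite (_ : _ \o _ = (fun x => (EFin \o cst 1%R) x +
    (EFin \o (fun x => ((d \_ `]0, 1[) x ^+ 2)%R)) x)%E); last by [].
  apply: integrableD => //.
    apply: (@integrableS _ _ _ mu `[0, 1]%classic) => //; first exact: subset_itv_oo_cc.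
    apply: continuous_compact_integrable; first exact: segment_compact.
    by apply: continuous_subspaceT => x; exact: cvg_cst.
  apply: (integrableS measurableT) => //.
  exact: (Lfun2_integrable_sqr d2).
Qed.

Lemma lebesgue_ae_imply (P Q : R -> Prop) : (forall x, P x -> Q x) ->
  {ae mu, forall x, P x} -> {ae mu, forall x, Q x}.
Proof. by move=> PQ; apply: filterS => //; exact: (ae_filter_ringOfSetsType mu). Qed.

Lemma ae_eq_Lfun2 (f g : R -> R) : measurable_fun setT g ->
  f \in Lfun mu 2%:E -> {ae mu, forall x, f x = g x} -> g \in Lfun mu 2%:E.
Proof.
move=> mg /andP[]; rewrite !inE => mf nf fg.
apply/andP; split; rewrite inE//.
rewrite /finLfun/= /finite_norm (_ : 'N[mu]_2[EFin \o g] = 'N[mu]_2[EFin \o f])%E//.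
rewrite unlock /=; congr (_ `^ _)%E.
have m2 (h : R -> R) : measurable_fun setT h ->
    measurable_fun setT (fun x => (`|(EFin \o h) x| `^ 2)%E).
  move=> mh; apply: (@measurableT_comp _ _ _ _ _ _ (fun x => (x `^ 2)%E)).
    exact: measurable_poweR.
  by apply: measurableT_comp => //; exact/measurable_EFinP.
apply: ae_eq_integral => //; [exact: m2|exact: m2|].
by apply: (lebesgue_ae_imply _ fg) => x /= ->.
Qed.

(** Composing with the retraction of the line onto [0, 1] turns continuity within
    [0, 1] into continuity on the whole line. *)
Definition clamp01 (x : R) : R := Num.max 0 (Num.min x 1).

Lemma clamp01_in x : 0 <= clamp01 x <= 1.
Proof. by rewrite /clamp01 le_max lexx ge_max ler01 ge_min lexx orbT. Qed.

Lemma clamp01_id x : 0 <= x <= 1 -> clamp01 x = x.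
Proof. by move=> /andP[x0 x1]; rewrite /clamp01 (min_idPl x1) (max_idPr x0). Qed.

Lemma clamp01_continuous : continuous clamp01.
Proof.
move=> x; apply: (@continuous_max R R (cst 0) (fun x => Num.min x 1)); first exact: cvg_cst.
by apply: (@continuous_min R R id (cst 1)); [exact: cvg_id|exact: cvg_cst].
Qed.

Lemma continuous_comp_clamp01 w : {within `[0, 1], continuous w} ->
  continuous (w \o clamp01).
Proof.
move=> /subspace_continuousP cw x.
have cx : `[0, 1]%classic (clamp01 x) by rewrite /= in_itv/= clamp01_in.
apply: (@cvg_comp _ _ _ clamp01 w _ (within `[0, 1] (nbhs (clamp01 x)))); last exact: cw.
move=> U; rewrite /within/= => WU.
have H : \forall y \near x, clamp01 y \in `[0, 1]%R -> U (clamp01 y).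
  exact: clamp01_continuous WU.
by apply: (filterS _ H) => y; apply; rewrite in_itv/= clamp01_in.
Qed.

Let primitive_closed w d : d \_ `]0, 1[ \in Lfun mu 2%:E ->
  (forall x, 0 <= x <= 1 -> w x = w 0 + \int[mu]_(t in `]0, x[) d t) ->
  forall x, 0 <= x <= 1 -> w x = w 0 + \int[mu]_(t in `[0, x]) (d \_ `]0, 1[) t.
Proof.
move=> d2 wd x /andP[x0 x1].
have fiS A : measurable A -> mu.-integrable A (EFin \o (d \_ `]0, 1[)).
  by move=> mA; exact: (integrableS measurableT _ _ (Lfun2_integrable01 d2)).
rewrite wd ?x0//; congr (_ + _).
rewrite -(Rintegral_itv_bndo_bndc (fiS _ _))// -Rintegral_itv_obnd_cbnd; last exact: fiS.
apply: eq_Rintegral => t; rewrite inE/= in_itv/= => /andP[t0 tx].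
by rewrite patchE ifT// inE/= in_itv/= t0 (lt_le_trans tx).
Qed.

Lemma primitive_continuous w d : d \_ `]0, 1[ \in Lfun mu 2%:E ->
  (forall x, 0 <= x <= 1 -> w x = w 0 + \int[mu]_(t in `]0, x[) d t) ->
  {within `[0, 1], continuous w}.
Proof.
move=> d2 wd.
apply: (@subspace_eq_continuous _ _ _
    (fun x => w 0 + parameterized_integral mu 0 x (d \_ `]0, 1[))).
  by move=> x; rewrite inE/= in_itv/= => /(primitive_closed d2 wd).
move=> x; apply: cvgD; first exact: cvg_cst.
apply: (parameterized_integral_continuous ler01).
exact: (integrableS measurableT _ _ (Lfun2_integrable01 d2)).
Qed.

(** Lebesgue's differentiation theorem identifies the derivative almost everywhere.
    The Borel sigma-algebra being incomplete, that does not make [w^`()] measurable: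
    its values on the exceptional null set are controlled by [measurable_derive1]. *)
Lemma primitive_sobolevH1 w d : d \_ `]0, 1[ \in Lfun mu 2%:E ->
  (forall x, 0 <= x <= 1 -> w x = w 0 + \int[mu]_(t in `]0, x[) d t) ->
  sobolevH1 0 1 w /\ {ae mu, forall x, 0 < x < 1 -> w^`() x = d x}.
Proof.
move=> d2 wd; have wf := primitive_closed d2 wd; have cw := primitive_continuous d2 wd.
set f := (d \_ `]0, 1[) in wf.
have fiS A : measurable A -> mu.-integrable A (EFin \o f).
  by move=> mA; exact: (integrableS measurableT _ _ (Lfun2_integrable01 d2)).
pose F (y : R) : R := \int[mu]_(t in `[0, y]) f t.
have mw' : measurable_fun (`]0, 1[%classic : set (measurableTypeR R)) w^`().
  apply: (@eq_measurable_fun _ _ _ _ _ (w \o clamp01)^`()); last first.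
    apply: measurable_funTS.
    exact: measurable_derive1 (continuous_comp_clamp01 cw).
  move=> x; rewrite inE/= in_itv/= => /andP[x0 x1]; rewrite !derive1E.
  apply: near_eq_derive; near=> y; rewrite /= clamp01_id//.
  by apply/andP; split; near: y; [exact: lt_le_nbhsr|exact: lt_le_nbhsl].
have mw : measurable_fun setT (w^`() \_ `]0, 1[).
  exact/(measurable_restrictT _ _).1.
have di : mu.-integrable `]0, 1[ (EFin \o d).
  apply: (@eq_integrable _ _ _ mu _ _ _ _ _ (fiS _ (measurable_itv _))) => //.
  by move=> x x01 /=; rewrite /f patchE x01.
have ae : {ae mu, forall x, 0 < x < 1 -> w^`() x = d x}.
  have := @FTC1 R f (BLeft 0) (fun y => fiS _ (measurable_itv _))
    (integrable_locally (measurable_itv _) di).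
  apply: lebesgue_ae_imply => x H /andP[x0 x1]; have [|dF Fx] := H; first by rewrite lte_fin.
  transitivity (f x); last by rewrite /f patchE ifT// inE/= in_itv/= x0.
  apply: is_derive1E; apply: (@near_eq_is_derive _ _ (fun y => w 0 + F y)).
    near=> y; apply: wf.
    by apply/andP; split; near: y; [exact: lt_le_nbhsr|exact: lt_le_nbhsl].
  rewrite -[f x]add0r; apply: is_derive1D.
  by rewrite -Fx; exact: derivable_is_derive.
split=> //; split.
  apply: ae_eq_Lfun2 mw d2 _; apply: (lebesgue_ae_imply _ ae) => x wx; rewrite !patchE.
  by case: ifPn => //; rewrite inE/= in_itv/= => /wx.
move=> x /[dup] x01 /andP[x0 x1]; rewrite wd//; congr (_ + _).
rewrite /Rintegral; congr fine.
have sub : `]0, x[ `<=` `]0, 1[ by apply: subset_itvl; rewrite bnd_simp.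
apply: ae_eq_integral => //.
- have := @integrableS _ _ _ mu `]0, 1[%classic `]0, x[%classic _ _ _ sub di.
  by move=> /(_ (measurable_itv _) (measurable_itv _)) /integrableP[].
- by apply/measurable_EFinP; apply: measurable_funS sub mw'.
- apply: (lebesgue_ae_imply _ ae) => t wt /= tx; congr EFin; apply/esym/wt.
  by have := sub _ tx; rewrite /= in_itv.
Unshelve. all: by end_near. Qed.

End sobolev.
(** * Ramps as test functions *)

Section test_functions.
Context {R : realType}.
Local Notation mu := (@lebesgue_measure R).
Local Notation I01 := (`]0, 1[%classic : set (measurableTypeR R)).

Lemma bounded_integrable01 (f : R -> R) (M : R) : measurable_fun I01 f ->
  (forall x : R, 0 < x < 1 -> `|f x| <= M) -> mu.-integrable I01 (EFin \o f).
Proof.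
move=> mf fM; apply: measurable_bounded_integrable => //.
  by rewrite [X in (X < _)%E]lebesgue_measure_itv/= lte_fin ltr01 -EFinB ltry.
exists M; split; first exact: num_real.
move=> N MN x; rewrite /= in_itv/= => /fM/le_trans; apply; exact: ltW.
Qed.

Lemma closed_integrable01 (f : R -> R) (x : R) : x <= 1 -> mu.-integrable I01 (EFin \o f) ->
  mu.-integrable `[0, x] (EFin \o f).
Proof.
move=> x1 /integrableP[/measurable_EFinP mf fi].
apply: (@integrableS _ _ _ mu `[0, 1]%classic) => //.
  by apply: subset_itvl; rewrite bnd_simp.
have mf' : measurable_fun (`[0, 1[%classic : set (measurableTypeR R)) f by exact/measurable_fun_itv_obnd_cbndP.
apply/integrableP; split; first by apply/measurable_EFinP/measurable_fun_itv_bndo_bndcP.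
rewrite -integral_itv_bndo_bndc; last by apply: measurableT_comp => //; exact/measurable_EFinP.
by rewrite -integral_itv_obnd_cbnd//; apply: measurableT_comp => //; exact/measurable_EFinP.
Qed.

Lemma bounded_Lfun2 (f : R -> R) (M : R) : measurable_fun I01 f ->
  (forall x : R, 0 < x < 1 -> `|f x| <= M) -> f \_ `]0, 1[ \in Lfun mu 2%:E.
Proof.
move=> mf fM.
have mfr : measurable_fun setT (f \_ `]0, 1[) by exact/(measurable_restrictT _ _).1.
apply/andP; split; rewrite inE//= /finite_norm unlock/=; apply: poweR_lty.
have : mu.-integrable setT (EFin \o ((fun x => f x ^+ 2) \_ I01)).
  rewrite -restrict_EFin; apply/integrable_restrict => //; rewrite setTI.
  apply: (@bounded_integrable01 _ (M ^+ 2)); first exact: measurable_funX.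
  move=> x /fM fxM; rewrite normrX lerXn2r ?nnegrE//; exact: le_trans fxM.
move=> /integrable_lty => /(_ measurableT).
apply: le_lt_trans; rewrite le_eqVlt; apply/orP; left; apply/eqP.
apply: eq_integral => x _ /=; rewrite !patchE; case: ifPn => _.
  by rewrite (powR_mulrn 2)// real_normK// num_real.
by rewrite normr0 powR0.
Qed.

(** The test functions are combinations of a constant and of the ramps
    [s |-> max (x - s) 0], whose derivatives are step functions: a weak
    formulation tested against them yields primitives of [u^`()], hence values
    of [u] itself, without integration by parts. *)
Definition ramp (x s : R) : R := Num.max 0 (x - s).
Definition ramp_slope (x s : R) : R := if s < x then -1 else 0.

Lemma ramp_ge0 x s : 0 <= ramp x s.
Proof. by rewrite /ramp le_max lexx. Qed.

Lemma ramp_slope_norm x s : `|ramp_slope x s| <= 1.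
Proof. by rewrite /ramp_slope; case: ifP => _; rewrite ?normrN1 ?normr0. Qed.

Lemma ramp_slope_measurable x (D : set (measurableTypeR R)) :
  measurable_fun D (ramp_slope x).
Proof.
apply: measurable_funTS; apply: measurable_fun_ifT => //.
exact: measurable_fun_ltr.
Qed.

Lemma ramp_primitive (x s : R) : 0 <= x -> 0 <= s ->
  ramp x s = ramp x 0 + \int[mu]_(t in `]0, s[) ramp_slope x t.
Proof.
move=> x0 s0.
have -> : \int[mu]_(t in `]0, s[) ramp_slope x t = - Num.min x s.
  rewrite (_ : \int[mu]_(t in `]0, s[) ramp_slope x t =
    \int[mu]_(t in `]0, s[) ((cst (-1 : R)) \_ `]-oo, x[) t); last first.
    apply: eq_Rintegral => t _; rewrite patchE /ramp_slope.
    by rewrite mem_setE in_itv.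
  rewrite -Rintegral_mkcondr.
  have -> : `]0, s[ `&` `]-oo, x[ = `]0, Num.min x s[%classic :> set R.
    apply/seteqP; split=> t; rewrite /= !in_itv/= lt_min.
      by move=> [/andP[-> ->] ->].
    by move=> /and3P[-> -> ->].
  rewrite Rintegral_cst// [X in _ * fine X]lebesgue_measure_itv/= lte_fin.
  case: ltP => [m0|]; first by rewrite -EFinB/= subr0 mulN1r.
  by move=> m0; rewrite mulr0; apply/eqP; rewrite eq_sym oppr_eq0 eq_le m0 le_min x0 s0.
rewrite /ramp subr0 (max_idPr x0); case: (leP x s) => xs.
  by rewrite subrr (max_idPl _)// subr_le0.
by rewrite (max_idPr _) ?subr_ge0 1?ltW//; ring.
Qed.

Lemma ramp_continuous x : continuous (ramp x).
Proof.
move=> s; apply: (@continuous_max R R (cst 0) (fun s => x - s)); first exact: cvg_cst.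
by apply: cvgB; [exact: cvg_cst|exact: cvg_id].
Qed.

Lemma Rintegral_ramp (h : R -> R) (x : R) : 0 <= x <= 1 ->
  \int[mu]_(s in `[0, 1]) (h s * ramp x s) = \int[mu]_(s in `[0, x]) (h s * (x - s)).
Proof.
move=> /andP[x0 x1].
rewrite (_ : `[0, x]%classic = `[0, 1] `&` `]-oo, x]); last first.
  apply/seteqP; split=> t; rewrite /= !in_itv/=.
    by move=> /andP[-> tx]; rewrite tx (le_trans tx).
  by move=> [/andP[-> _] ->].
rewrite Rintegral_mkcondr; apply: eq_Rintegral => s _.
rewrite patchE mem_setE in_itv/= /ramp; case: leP => sx.
  by rewrite (max_idPr _)// subr_ge0.
by rewrite (max_idPl _) ?mulr0// subr_le0 ltW.
Qed.

Lemma ramp_mean (x : R) : 0 < x <= 1 -> \int[mu]_(s in `[0, 1]) ramp x s = x ^+ 2 / 2.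
Proof.
move=> /andP[x0 x1].
under eq_Rintegral do rewrite -[ramp _ _]mul1r.
rewrite (Rintegral_ramp (cst 1)) ?(ltW x0)// /Rintegral.
have dF (s : R) : is_derive s 1 (fun s : R => x * s - s ^+ 2 / 2) (cst 1 s * (x - s)).
  apply: (is_derive_eq (is_derive1B (is_derive1Z x (is_derive1_id s))
    (is_derive1M (is_derive1X 2 (is_derive1_id s)) (is_derive1_cst 2^-1 s)))).
  by rewrite /=; field.
rewrite (@continuous_FTC2 _ _ (fun s : R => x * s - s ^+ 2 / 2))//=.
- by field.
- apply: continuous_subspaceT => s; apply: cvgM; first exact: cvg_cst.
  by apply: cvgB; [exact: cvg_cst|exact: cvg_id].
- split.
  + by move=> s _; exact: is_derive_derivable (dF s).
  + exact/cvg_at_right_filter/(is_derive_continuous (dF 0)).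
  + exact/cvg_at_left_filter/(is_derive_continuous (dF x)).
- by move=> s _; exact: is_derive1E (dF s).
Qed.

End test_functions.
(** * The weak formulation tested against ramps *)

Section weak_formulation.
Context {R : realType}.
Local Notation mu := (@lebesgue_measure R).
Local Notation I01 := (`]0, 1[%classic : set (measurableTypeR R)).
Variables (eps : R) (u : calH R) (g : R -> R) (M : R).
Hypothesis mg : measurable_fun I01 g.
Hypothesis gM : forall x : R, 0 < x < 1 -> `|g x| <= M.
Hypothesis VI : forall v, calK v -> 0 <= \int[mu]_(s in `[0, 1])
  (eps * u^`() s * (v^`() s - u^`() s) + g s * (v s - u s)).

Let integrable_sub (A B : set (measurableTypeR R)) (f : R -> R) : measurable A ->
  measurable B -> A `<=` B -> mu.-integrable B (EFin \o f) -> mu.-integrable A (EFin \o f).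
Proof. by move=> mA mB AB; exact: integrableS. Qed.

Let integrable_Z (A : set (measurableTypeR R)) (k : R) (f : R -> R) : measurable A ->
  mu.-integrable A (EFin \o f) -> mu.-integrable A (EFin \o (fun x => k * f x)).
Proof. by move=> mA fi; apply: (@integrableZl _ _ _ mu A mA k (EFin \o f)). Qed.

Let integrable_D (A : set (measurableTypeR R)) (f h : R -> R) : measurable A ->
  mu.-integrable A (EFin \o f) -> mu.-integrable A (EFin \o h) ->
  mu.-integrable A (EFin \o (fun x => f x + h x)).
Proof. by move=> mA fi hi; apply: (@integrableD _ _ _ mu A mA (EFin \o f) (EFin \o h)). Qed.

Lemma calH_continuous (v : calH R) : {within `[0, 1], continuous v}.
Proof. by have [d2 vd] := calH_H1 v; exact: primitive_continuous d2 vd. Qed.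

Lemma calH_derive_integrable (v : calH R) : mu.-integrable I01 (EFin \o v^`()).
Proof.
have [d2 _] := calH_H1 v.
have := integrable_sub (measurable_itv `]0, 1[%R) measurableT (@subsetT _ _)
  (Lfun2_integrable01 d2).
by apply: eq_integrable => // x x01 /=; rewrite patchE x01.
Qed.

Let continuous_integrable01 (f : R -> R) : {within `[0, 1], continuous f} ->
  mu.-integrable `[0, 1] (EFin \o f).
Proof. by move=> cf; apply: continuous_compact_integrable => //; exact: segment_compact. Qed.

Let gi : mu.-integrable I01 (EFin \o g) := bounded_integrable01 mg gM.

Let ramp_le1 (x s : R) : 0 < x <= 1 -> 0 < s < 1 -> `|ramp x s| <= 1.
Proof.
move=> /andP[x0 x1] /andP[s0 s1]; rewrite ger0_norm ?ramp_ge0//.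
by rewrite /ramp ge_max ler01/=; lra.
Qed.

Let g_ramp_int (x : R) : 0 < x <= 1 -> mu.-integrable I01 (EFin \o (fun s => g s * ramp x s)).
Proof.
move=> x01; apply: (@bounded_integrable01 _ _ M).
  apply: measurable_funM => //; apply: measurable_funTS.
  exact: continuous_measurable_fun (@ramp_continuous _ x).
move=> s s01; rewrite normrM -[leRHS]mulr1 ler_pM//; [exact: gM|exact: ramp_le1].
Qed.

Let u_slope_int (x : R) :
  mu.-integrable I01 (EFin \o (fun s => eps * u^`() s * ramp_slope x s)).
Proof.
rewrite (_ : _ \o _ = ((EFin \o (fun s => (eps * ramp_slope x s)%R)) \* (EFin \o u^`()))%E); last first.
  by apply/funext => s /=; rewrite -EFinM; congr EFin; ring.
apply: integrableMr => //; last exact: calH_derive_integrable.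
  by apply: measurable_funM => //; exact: ramp_slope_measurable.
exists `|eps|; split; first exact: num_real.
move=> N epsN s _ /=; rewrite normrM (le_trans _ (ltW epsN))//.
by rewrite -[leRHS]mulr1 ler_wpM2l// ramp_slope_norm.
Qed.

(** The first variation of the energy in the direction of a ramp. *)
Definition ramp_variation (x : R) : R :=
  \int[mu]_(s in `]0, 1[) (eps * u^`() s * ramp_slope x s + g s * ramp x s).

(** The zero mean condition on the combination of a constant and two ramps makes
    its sum with [u] an element of [calH], hence a competitor in the variational
    inequality; the latter is linear in the perturbation. *)
Lemma ramp_variation_ge0 (al b c x a : R) : 0 < x <= 1 -> 0 < a <= 1 ->
  al + b * (x ^+ 2 / 2) + c * (a ^+ 2 / 2) = 0 ->
  (forall s, 0 <= s <= 1 -> -1 <= u s + (al + b * ramp x s + c * ramp a s)) ->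
  0 <= al * (\int[mu]_(s in `]0, 1[) g s) + b * ramp_variation x + c * ramp_variation a.
Proof.
move=> x01 a01 mean0 adm.
pose phi s := al + b * ramp x s + c * ramp a s.
pose psi s := b * ramp_slope x s + c * ramp_slope a s.
pose d s := u^`() s + psi s.
pose v0 s := if 0 <= s <= 1 then u s + phi s else 0.
have mpsi : measurable_fun setT psi.
  by apply: measurable_funD; apply: measurable_funM => //; exact: ramp_slope_measurable.
have psiM s : `|psi s| <= `|b| + `|c|.
  apply: le_trans (ler_normD _ _) _; rewrite !normrM.
  by apply: lerD; rewrite -[leRHS]mulr1 ler_wpM2l// ramp_slope_norm.
have d2 : d \_ `]0, 1[ \in Lfun mu 2%:E.
  rewrite (_ : _ \_ _ = (u^`() \_ `]0, 1[) + (psi \_ `]0, 1[)); last first.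
    by apply/funext => s; rewrite fctE !patchE; case: ifP => _; rewrite ?addr0.
  apply: (Lfun_addr_closed mu (lee1n 2)).2; first exact: (calH_H1 u).1.
  by apply: (@bounded_Lfun2 _ _ (`|b| + `|c|)) => //; exact: measurable_funTS.
have slope_int y s : 0 <= s <= 1 -> mu.-integrable `]0, s[ (EFin \o ramp_slope y).
  move=> /andP[s0 s1]; apply: (@integrable_sub _ I01) => //.
    by apply: subset_itvl; rewrite bnd_simp.
  apply: (@bounded_integrable01 _ _ 1); first exact: ramp_slope_measurable.
  by move=> t _; exact: ramp_slope_norm.
have vd s : 0 <= s <= 1 -> v0 s = v0 0 + \int[mu]_(t in `]0, s[) d t.
  move=> /[dup] s01 /andP[s0 s1].
  have bx := integrable_Z b (measurable_itv _) (slope_int x _ s01).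
  have ca := integrable_Z c (measurable_itv _) (slope_int a _ s01).
  have us : mu.-integrable `]0, s[ (EFin \o u^`()).
    apply: (@integrable_sub _ I01) => //; last exact: calH_derive_integrable.
    by apply: subset_itvl; rewrite bnd_simp.
  rewrite RintegralD//; last by apply: integrable_D.
  rewrite RintegralD// !RintegralZl//; try exact: slope_int.
  rewrite /v0 s01 lexx ler01/= (calH_H1 u).2// /phi.
  rewrite [in LHS](@ramp_primitive _ x s) ?[in LHS](@ramp_primitive _ a s)//; last 2 first.
  - by lra.
  - by lra.
  by ring.
have [v1 vae] := primitive_sobolevH1 d2 vd.
have ci (f : R -> R) : continuous f -> mu.-integrable `[0, 1] (EFin \o f).
  by move=> cf; apply: continuous_integrable01; exact: continuous_subspaceT.
have ri y := ci _ (@ramp_continuous _ y).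
have v2 : \int[mu]_(s in `[0, 1]) v0 s = 0.
  transitivity (\int[mu]_(s in `[0, 1]) (u s + (cst al s + b * ramp x s + c * ramp a s))).
    by apply: eq_Rintegral => s; rewrite inE/= in_itv/= /v0 => ->.
  have bx := integrable_Z b (measurable_itv _) (ri x).
  have ca := integrable_Z c (measurable_itv _) (ri a).
  have al_int : mu.-integrable `[0, 1] (EFin \o cst al) by apply: ci => ?; exact: cvg_cst.
  have ui := continuous_integrable01 (@calH_continuous u).
  rewrite RintegralD//; last by apply: integrable_D => //; exact: integrable_D.
  rewrite RintegralD//; last by apply: integrable_D.
  rewrite RintegralD// !RintegralZl// Rintegral_cst// (calH_mean u) !ramp_mean//.
  rewrite [X in _ * fine X]lebesgue_measure_itv/= lte_fin ltr01 -EFinB subr0 mulr1.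
  by rewrite add0r.
have v3 s : ~~ (0 <= s <= 1) -> v0 s = 0 by rewrite /v0 => /negbTE ->.
pose v := CalH v1 v2 v3.
have Kv : calK v by move=> s s01; rewrite /= /v0 s01; exact: adm.
have := VI Kv.
have ig y : 0 < y <= 1 -> mu.-integrable I01
    (EFin \o (fun s : R => eps * u^`() s * ramp_slope y s + g s * ramp y s)).
  by move=> y01; apply: integrable_D => //; exact: g_ramp_int.
suff -> : \int[mu]_(s in `[0, 1])
  (eps * u^`() s * (v^`() s - u^`() s) + g s * (v s - u s)) =
  \int[mu]_(s in `]0, 1[) (al * g s + b * (eps * u^`() s * ramp_slope x s + g s * ramp x s) +
     c * (eps * u^`() s * ramp_slope a s + g s * ramp a s)).
  have i1 := integrable_Z al (measurable_itv _) gi.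
  have i2 := integrable_Z b (measurable_itv _) (ig x x01).
  have i3 := integrable_Z c (measurable_itv _) (ig a a01).
  rewrite RintegralD//; last by apply: integrable_D.
  by rewrite RintegralD// !RintegralZl//; exact: ig.
have mE (f : R -> R) : mu.-integrable I01 (EFin \o f) -> measurable_fun I01 f.
  by move=> /integrableP[/measurable_EFinP].
have mC (f : calH R) : measurable_fun I01 f.
  apply: mE; apply: (@integrable_sub _ `[0, 1]%classic) => //.
    exact: subset_itv_oo_cc.
  exact: continuous_integrable01 (@calH_continuous f).
have mD (f : calH R) : measurable_fun I01 f^`() := mE _ (calH_derive_integrable f).
have mF : measurable_fun I01 (fun s => eps * u^`() s * (v^`() s - u^`() s) + g s * (v s - u s)).
  apply: measurable_funD; apply: measurable_funM => //.
  - exact: measurable_funM.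
  - exact: measurable_funB.
  - exact: measurable_funB.
rewrite /Rintegral -integral_itv_bndo_bndc; last first.
  by apply/emeasurable_fun_itv_obnd_cbndP/measurable_EFinP.
rewrite -integral_itv_obnd_cbnd; last exact/measurable_EFinP.
congr fine; apply: ae_eq_integral => //; [exact/measurable_EFinP| |].
  apply/measurable_EFinP; apply: measurable_funD; first apply: measurable_funD.
  - exact: measurable_funM.
  - by apply: measurable_funM => //; apply: mE; exact: ig.
  - by apply: measurable_funM => //; apply: mE; exact: ig.
apply: (lebesgue_ae_imply _ vae) => s vs; rewrite /= in_itv/= => /andP[s0 s1].
rewrite vs ?s0// {1}/v0 (ltW s0) (ltW s1)/= /d /psi /phi; congr EFin; ring.
Qed.

(** Against the step function [ramp_slope x], the derivative of [u] integrates to an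
    increment of [u]. *)
Lemma ramp_variationE (x : R) : 0 < x <= 1 -> ramp_variation x =
  - (eps * (u x - u 0)) + (x * \int[mu]_(s in `[0, x]) g s - \int[mu]_(s in `[0, x]) (s * g s)).
Proof.
move=> /[dup] x01 /andP[x0 x1].
have gx : mu.-integrable `[0, x] (EFin \o g) by exact: closed_integrable01.
have sgx : mu.-integrable `[0, x] (EFin \o (fun s => s * g s)).
  apply: closed_integrable01 => //; apply: (@bounded_integrable01 _ _ M).
    exact: measurable_funM.
  move=> s /[dup] s01 /andP[s0 s1]; rewrite normrM -[leRHS]mul1r ler_pM//; last exact: gM.
  by rewrite gtr0_norm// ltW.
rewrite /ramp_variation RintegralD//; last exact: g_ramp_int.
congr (_ + _).
  transitivity (\int[mu]_(s in `]0, 1[) ((fun s => - eps * u^`() s) \_ `]-oo, x[) s).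
    apply: eq_Rintegral => s _; rewrite patchE mem_setE in_itv/= /ramp_slope.
    by case: ifP => _; rewrite ?mulr0// mulrN1 mulNr.
  rewrite -Rintegral_mkcondr.
  have -> : `]0, 1[ `&` `]-oo, x[ = `]0, x[%classic :> set R.
    apply/seteqP; split=> t; rewrite /= !in_itv/=; first by move=> [/andP[-> _] ->].
    by move=> /andP[-> tx]; split=> //; lra.
  rewrite RintegralZl//; last first.
    apply: (@integrable_sub _ I01) => //; last exact: calH_derive_integrable.
    by apply: subset_itvl; rewrite bnd_simp.
  rewrite [in RHS]((calH_H1 u).2 x) ?(ltW x0)//.
  by rewrite [u 0 + _]addrC addrK mulNr.
transitivity (\int[mu]_(s in `[0, 1]) (g s * ramp x s)).
  have gr := closed_integrable01 (lexx 1) (g_ramp_int x01).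
  rewrite Rintegral_itv_obnd_cbnd; last first.
    apply: (@integrable_sub _ `[0, 1]%classic) => //.
    exact: subset_itv_oo_cc.
  rewrite Rintegral_itv_bndo_bndc//; apply: (@integrable_sub _ `[0, 1]%classic) => //.
  exact: subset_itv_co_cc.
rewrite Rintegral_ramp; last by rewrite (ltW x0).
rewrite -RintegralZl// -RintegralB//; last exact: integrable_Z.
by apply: eq_Rintegral => s _; rewrite mulrBr mulrC [g s * s]mulrC.
Qed.


End weak_formulation.
(** * Regularity, first integral and energy of a fractured solution *)

Section fractured_solution.
Context {R : realType} (W : R -> R) (gamma kappa : R).
Hypothesis hW : stored_energy W gamma kappa.
Local Notation mu := (@lebesgue_measure R).
Local Notation I01 := (`]0, 1[%classic : set (measurableTypeR R)).
Variables (eps lam : R) (u : calH R).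
Hypothesis eps_gt0 : 0 < eps.
Hypothesis sol : solution_pair W gamma eps (lam, u).
Hypothesis u_decreasing : forall x y : R, 0 <= x -> x < y -> y <= 1 -> u y < u x.
Hypothesis u1 : u 1 = -1.
Implicit Types x s : R.

Let lam_gt0 : 0 < lam. Proof. by case: sol. Qed.

(** The inverse stretch as a function of the reference variable [s = y / lam]. *)
Definition inv_stretch s := (1 + u s) / lam.
Local Notation rho := inv_stretch.
Definition stress s := lam ^+ 3 * dWstar W gamma (rho s).
Local Notation g := stress.
Local Notation m := (rho 0).

Let u_gtN1 s : 0 <= s -> s < 1 -> -1 < u s.
Proof. by move=> s0 s1; rewrite -u1; apply: u_decreasing. Qed.

Lemma inv_stretch1 : rho 1 = 0.
Proof. by rewrite /inv_stretch u1 subrr mul0r. Qed.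

Lemma inv_stretch_gt0 s : 0 <= s -> s < 1 -> 0 < rho s.
Proof. by move=> s0 s1; rewrite divr_gt0//; have := u_gtN1 s0 s1; lra. Qed.

Lemma inv_stretch_decreasing x y : 0 <= x -> x < y -> y <= 1 -> rho y < rho x.
Proof. by move=> x0 xy y1; rewrite ltr_pM2r ?invr_gt0// ltrD2l u_decreasing. Qed.

Lemma inv_stretch_continuous : {within `[0, 1], continuous rho}.
Proof.
move=> x; apply: cvgM; last exact: cvg_cst.
by apply: cvgD; [exact: cvg_cst|exact: calH_continuous].
Qed.

Let rho_continuous s : 0 < s < 1 -> {for s, continuous rho}.
Proof.
move=> s01; apply: (within_continuous_continuous ltr01 inv_stretch_continuous).
by rewrite in_itv.
Qed.

Let stress_near s : 0 < s < 1 -> \near s, g s = lam ^+ 3 * (WstarR W)^`() (rho s).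
Proof.
move=> /andP[s0 s1]; near=> t; rewrite /stress /dWstar gt_eqF// inv_stretch_gt0//.
  by apply: ltW; near: t; exact: lt_nbhsr.
by near: t; exact: lt_nbhsl.
Unshelve. all: by end_near. Qed.

Let stress_continuous s : 0 < s < 1 -> {for s, continuous g}.
Proof.
move=> /[dup] s01 /andP[s0 s1]; rewrite /prop_for /continuous_at.
apply: (@cvg_trans _ (lam ^+ 3 * (WstarR W)^`() (rho t) @[t --> s])).
  by apply: near_eq_cvg; apply: filterS (stress_near s01) => t ->.
have -> : g s = lam ^+ 3 * (WstarR W)^`() (rho s) := nbhs_singleton (stress_near s01).
apply: (@cvgM _ _ (nbhs s) _ (fun=> lam ^+ 3) (fun t => (WstarR W)^`() (rho t))).
  exact: cvg_cst.
apply: continuous_comp; first exact: rho_continuous.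
by apply: (WstarR_derive_continuous hW); apply: inv_stretch_gt0 => //; exact: ltW.
Qed.

Let stress_measurable : measurable_fun I01 g.
Proof.
apply: open_continuous_measurable_fun => //.
by move=> s; rewrite inE/= in_itv/=; exact: stress_continuous.
Qed.

Let stress_bounded : exists M, forall s, 0 < s < 1 -> `|g s| <= M.
Proof.
have [M HM] := dWstar_bounded hW m; exists (lam ^+ 3 * M) => s /andP[s0 s1].
rewrite normrM gtr0_norm ?exprn_gt0// ler_pM2l ?exprn_gt0//.
by apply: HM; rewrite inv_stretch_gt0 ?(ltW s0)//= ltW// inv_stretch_decreasing// ltW.
Qed.

Let VI v : calK v -> 0 <= \int[mu]_(s in `[0, 1])
  (eps * u^`() s * (v^`() s - u^`() s) + g s * (v s - u s)).
Proof. by move=> Kv; case: sol => _ _ H; exact: (H v Kv). Qed.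

Local Notation T := (ramp_variation eps u g).

(** On compact parts of [0, 1) the constraint is inactive, so the variation
    vanishes on combinations of two ramps of zero mean: it is a multiple of the
    mean of the ramp, the multiple being the Lagrange multiplier. *)
Let K := 8 * T (1 / 2).

Let variationE x : 0 < x < 1 -> T x = K * (x ^+ 2 / 2).
Proof.
move=> /andP[x0 x1]; have [M gM] := stress_bounded.
pose a : R := 1 / 2; pose z := Num.max x a.
have zx : x <= z by rewrite le_max lexx.
have za : a <= z by rewrite le_max lexx orbT.
have z1 : z < 1 by rewrite gt_max x1 /a; lra.
have uz : -1 < u z by apply: u_gtN1 => //; lra.
have sgn t : `|t| <= (1 + u z) / 2 ->
    0 <= 0 * (\int[mu]_(s in `]0, 1[) g s) + t * a ^+ 2 * T x + - t * x ^+ 2 * T a.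
  move=> tz; apply: (ramp_variation_ge0 stress_measurable gM VI).
  - by lra.
  - by rewrite /a; lra.
  - by field.
  move=> s /andP[s0 s1]; rewrite add0r.
  have [zs|sz] := leP z s.
    rewrite /ramp !(max_idPl _) ?subr_le0 ?(le_trans zx)// ?(le_trans za)//.
    by rewrite !mulr0 !addr0; case: sol => _ Ku _; apply: Ku; rewrite s0.
  have us : u z <= u s by apply: ltW; apply: u_decreasing => //; exact: ltW.
  have rb y y' : 0 < y < 1 -> 0 < y' < 1 -> 0 <= y' ^+ 2 * ramp y s <= 1.
    move=> y01 y'01; have r01 : 0 <= ramp y s <= 1.
      by rewrite ramp_ge0 /ramp ge_max ler01/=; lra.
    have y2 : 0 <= y' ^+ 2 <= 1 by nra.
    by nra.
  have a01 : 0 < a < 1 by rewrite /a; lra.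
  have x01 : 0 < x < 1 by lra.
  have A01 := rb x a x01 a01; have B01 := rb a x a01 x01.
  have -> : t * a ^+ 2 * ramp x s + - t * x ^+ 2 * ramp a s =
    t * (a ^+ 2 * ramp x s - x ^+ 2 * ramp a s) by ring.
  set A := a ^+ 2 * _ in A01 *; set B := x ^+ 2 * _ in B01 *.
  have : - `|t| <= t * (A - B).
    rewrite lerNl -mulrN; apply: le_trans (ler_norm _) _.
    by rewrite normrM normrN -[leRHS]mulr1 ler_wpM2l// ler_norml; lra.
  by lra.
have t0 : 0 < (1 + u z) / 2 by rewrite divr_gt0//; lra.
have := sgn ((1 + u z) / 2); have := sgn (- ((1 + u z) / 2)).
rewrite normrN gtr0_norm// => /(_ (lexx _)) s1 /(_ (lexx _)) s2.
have E : a ^+ 2 * T x - x ^+ 2 * T a = 0.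
  by apply: (mulfI (lt0r_neq0 t0)); rewrite mulr0; lra.
by move: E; rewrite /K /a; lra.
Qed.

Let G x := \int[mu]_(s in `[0, x]) g s.
Let Gid x := \int[mu]_(s in `[0, x]) (s * g s).

Let stress_integrable : mu.-integrable `[0, 1] (EFin \o g).
Proof.
have [M gM] := stress_bounded.
exact: (closed_integrable01 (lexx 1) (bounded_integrable01 stress_measurable gM)).
Qed.

Let stress_id_integrable : mu.-integrable `[0, 1] (EFin \o (fun s => s * g s)).
Proof.
have [M gM] := stress_bounded.
apply: (closed_integrable01 (lexx 1)); apply: (@bounded_integrable01 _ _ M).
  exact: measurable_funM.
move=> s /[dup] s01 /andP[s0 s1]; rewrite normrM -[leRHS]mul1r ler_pM//; last exact: gM.
by rewrite gtr0_norm// ltW.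
Qed.

Let G_is_derive x : 0 < x < 1 -> is_derive x 1 G (g x).
Proof.
move=> /[dup] x01 /andP[x0 x1].
have [dG <-] := continuous_FTC1_closed x1 stress_integrable x0 (stress_continuous x01).
exact: derivable_is_derive.
Qed.

Let Gid_is_derive x : 0 < x < 1 -> is_derive x 1 Gid (x * g x).
Proof.
move=> /[dup] x01 /andP[x0 x1].
have cs : {for x, continuous (fun s => s * g s)}.
  by apply: cvgM; [exact: cvg_id|exact: stress_continuous].
have [dG <-] := continuous_FTC1_closed x1 stress_id_integrable x0 cs.
exact: derivable_is_derive.
Qed.

Let G_continuous : {within `[0, 1], continuous G}.
Proof. exact: parameterized_integral_continuous ler01 stress_integrable. Qed.

Let G0 : G 0 = 0. Proof. by rewrite /G set_itv1 Rintegral_set1. Qed.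

(** Lifting the end point [s = 1], where the constraint is active, is an admissible
    direction, in one sense only; the inequality is [0 <= u' 1]. *)
Let multiplier_le : K <= G 1.
Proof.
have [M gM] := stress_bounded.
(* The direction [1 - 8 ramp a] has zero mean; it is at least [-3], and is negative
   only on [[0, a]], where [u] is at least [u a > -1]. *)
pose a : R := 1 / 2; pose t := (1 + u a) / 8.
have a01 : 0 < a < 1 by rewrite /a; lra.
have ua : -1 < u a by apply: u_gtN1; rewrite /a; lra.
have t0 : 0 < t by rewrite divr_gt0//; lra.
have : 0 <= t * (\int[mu]_(s in `]0, 1[) g s) + - 8 * t * T a + 0 * T a.
  apply: (ramp_variation_ge0 stress_measurable gM VI).
  - by rewrite /a; lra.
  - by rewrite /a; lra.
  - by rewrite /a; field.
  move=> s /andP[s0 s1]; rewrite mul0r addr0.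
  have [as_|sa] := leP a s.
    rewrite /ramp (max_idPl _) ?subr_le0// mulr0 addr0.
    have : -1 <= u s by case: sol => _ Ku _; apply: Ku; rewrite s0.
    by lra.
  have us : u a <= u s by apply: ltW; apply: u_decreasing => //; rewrite /a; lra.
  have r01 : 0 <= ramp a s <= 1 by rewrite ramp_ge0 /ramp ge_max ler01/=; move: sa; rewrite /a; lra.
  have tr : t * ramp a s <= t by rewrite -[leRHS]mulr1 ler_pM2l//; lra.
  have tE : 8 * t = 1 + u a by rewrite /t; field.
  have -> : t + -8 * t * ramp a s = t - 8 * (t * ramp a s) by ring.
  by clearbody t a; lra.
rewrite (variationE a01).
have -> : \int[mu]_(s in `]0, 1[) g s = G 1.
  rewrite Rintegral_itv_obnd_cbnd; last first.
    apply: (@integrableS _ _ _ mu `[0, 1]%classic) => //.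
    exact: subset_itv_oo_cc.
  rewrite Rintegral_itv_bndo_bndc//; apply: (@integrableS _ _ _ mu `[0, 1]%classic) => //.
  exact: subset_itv_co_cc.
move=> H; suff : 0 <= t * (G 1 - K) by rewrite pmulr_rge0// subr_ge0.
by move: H; rewrite /a; clearbody t; lra.
Qed.

(** The derivative of [u], extended continuously to the closed interval. *)
Definition slope x := (G x - K * x) / eps.
Local Notation du := slope.

Let slope0 : du 0 = 0. Proof. by rewrite /slope G0; field; rewrite gt_eqF. Qed.

Let slope_continuous : {within `[0, 1], continuous du}.
Proof.
move=> x; apply: cvgM; last exact: cvg_cst.
apply: cvgB; first exact: G_continuous.
by apply: cvgM; [exact: cvg_cst|apply: continuous_subspaceT => y; exact: cvg_id].
Qed.

(** The identity [variationE] expresses [u] by primitives of the bounded stress, so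
    [u] is twice differentiable and the natural condition [u' 0 = 0] is built in. *)
Lemma u_is_derive x : 0 < x < 1 -> is_derive x 1 u (du x).
Proof.
move=> x01; have [x0 x1] := andP x01; have [M gM] := stress_bounded.
have uE y : 0 < y < 1 -> u y = u 0 + (y * G y - Gid y - K * (y ^+ 2 / 2)) / eps.
  move=> y01; have := variationE y01.
  rewrite (@ramp_variationE _ eps u g M stress_measurable gM); last by lra.
  rewrite -/(G y) -/(Gid y) => <-; field; exact: lt0r_neq0.
apply: (@near_eq_is_derive _ _
    (fun y => u 0 + (y * G y - Gid y - K * (y ^+ 2 / 2)) / eps)).
  by near=> y; apply: uE; apply/andP; split; near: y; [exact: lt_nbhsr|exact: lt_nbhsl].
have dsq := is_derive1M (is_derive1X 2 (is_derive1_id x)) (is_derive1_cst (2^-1 : R) x).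
have dn := is_derive1B (is_derive1B (is_derive1M (is_derive1_id x) (G_is_derive x01))
  (Gid_is_derive x01)) (is_derive1Z K dsq).
apply: (is_derive_eq (is_derive1D (is_derive1_cst (u 0) x)
  (is_derive1M dn (is_derive1_cst eps^-1 x)))).
by rewrite /slope /=; field; exact: lt0r_neq0.
Unshelve. all: by end_near. Qed.

Let slope_is_derive x : 0 < x < 1 -> is_derive x 1 du ((g x - K) / eps).
Proof.
move=> x01.
apply: (is_derive_eq (is_derive1M (is_derive1B (G_is_derive x01)
  (is_derive1Z K (is_derive1_id x))) (is_derive1_cst eps^-1 x))).
by rewrite mulr0 addr0 mulr1.
Qed.

Lemma slope_le0 x : 0 < x < 1 -> du x <= 0.
Proof.
move=> x01; apply: (nonincreasing_is_derive_le0 (b := 1) (u_is_derive x01)); first by lra.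
by move=> y xy1; apply: ltW; apply: u_decreasing; lra.
Qed.

(** The contact with the constraint is tangential: [u' 1 >= 0] because the end point
    can be lifted, and [u' 1 <= 0] because [u] is decreasing. *)
Let slope1 : du 1 = 0.
Proof.
apply/eqP; rewrite eq_le; apply/andP; split; last first.
  by rewrite divr_ge0 ?(ltW eps_gt0)// mulr1 subr_ge0.
have [_ _ d1] := (continuous_within_itvP _ (@ltr01 R)).1 slope_continuous.
apply: (cvgr_to_le d1); near=> x; apply: slope_le0.
apply/andP; split; first by near: x; exact: nbhs_left_gt.
by near: x; exact: nbhs_left_lt.
Unshelve. all: by end_near. Qed.

(** The Lagrange multiplier of the mean value constraint, in the units of the
    equation [Wstar' H - eps * H'' = multiplier] for the inverse stretch. *)
Definition multiplier := K / lam ^+ 3.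
Local Notation k := multiplier.

(** Conservation of energy along the profile; [Wstar 0 = 0] and the tangential
    contact at [s = 1] make the constant vanish. *)
Lemma first_integral x : 0 <= x <= 1 ->
  eps / 2 * du x ^+ 2 = lam ^+ 4 * (WstarR W (rho x) - k * rho x).
Proof.
move=> /andP[x0 x1].
pose E y := eps / 2 * du y ^+ 2 - lam ^+ 4 * (WstarR W (rho y) - k * rho y).
have cE : {within `[0, 1], continuous E}.
  move=> y; apply: cvgB; (apply: cvgM; first exact: cvg_cst).
    apply: (within_continuous_comp_continuous (g := fun z => z ^+ 2) slope_continuous).
    exact: exprn_continuous.
  apply: cvgB; last first.
    by apply: cvgM; [exact: cvg_cst|exact: inv_stretch_continuous].
  apply: (within_continuous_comp_continuous inv_stretch_continuous).
  exact: (WstarR_continuous hW).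
suff : E x = E 1 by rewrite /E slope1 inv_stretch1 WstarR0; lra.
apply: (is_derive0_within_eq x1) => [y /andP[xy y1]|].
  have y01 : 0 < y < 1 by lra.
  have drho : is_derive y 1 rho (du y / lam).
    apply: (is_derive_eq (is_derive1M (is_derive1D (is_derive1_cst 1 y) (u_is_derive y01))
      (is_derive1_cst lam^-1 y))).
    by rewrite add0r mulr0 addr0.
  have rhoy : 0 < rho y by apply: inv_stretch_gt0; lra.
  have dW : is_derive (rho y) 1 (WstarR W) ((WstarR W)^`() (rho y)).
    by apply: derivable_is_derive; exact: is_derive_derivable (WstarR_is_derive hW rhoy).
  apply: (is_derive_eq (is_derive1B (is_derive1Z (eps / 2) (is_derive1X 2 (slope_is_derive y01)))
    (is_derive1Z (lam ^+ 4) (is_derive1B (is_derive1_chain dW drho) (is_derive1Z k drho))))).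
  rewrite (nbhs_singleton (stress_near y01)) /multiplier /=.
  by field; rewrite !gt_eqF.
apply: continuous_subspaceW cE.
by apply: subset_itvr; rewrite bnd_simp.
Qed.

(** The first integral at [s = 0], where the slope vanishes. *)
Lemma multiplierE : k = W m^-1.
Proof.
have m0 : 0 < m by apply: inv_stretch_gt0.
have := @first_integral 0; rewrite lexx ler01 => /(_ isT).
rewrite slope0 expr0n/= mulr0 => /esym/eqP.
rewrite mulf_eq0 expf_eq0/= gt_eqF//= subr_eq0 WstarR_gt0E// => /eqP.
by rewrite mulrC => /(mulIf (lt0r_neq0 m0)).
Qed.

Lemma multiplier_ge0 : 0 <= k.
Proof. by rewrite multiplierE; apply: (W_ge0 hW); rewrite invr_gt0 inv_stretch_gt0. Qed.

(** Otherwise the solution would pass through the well, where the first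
    integral makes the multiplier nonpositive. *)
Lemma inv_stretch_le1 : m <= 1.
Proof.
rewrite leNgt; apply/negP => m1.
have [|s] := IVT ler01 inv_stretch_continuous (v := 1).
  rewrite inv_stretch1 ge_min le_max.
  by apply/andP; split; apply/orP; [right; exact: ler01|left; exact: ltW].
rewrite in_itv/= => s01 rs1; have := first_integral s01.
rewrite rs1 WstarR_gt0E// invr1 (W_at1 hW) mul1r sub0r mulr1 => E.
have k0 : 0 < k.
  rewrite multiplierE; apply: (W_gt0 hW); first by rewrite invr_gt0 inv_stretch_gt0.
  by rewrite invr_eq1 gt_eqF.
have : 0 <= eps / 2 * slope s ^+ 2 by rewrite mulr_ge0 ?sqr_ge0// divr_ge0 ?(ltW eps_gt0).
by rewrite E mulrN oppr_ge0 leNgt mulr_gt0// exprn_gt0.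
Qed.

Let U x := \int[mu]_(s in `[0, x]) (1 + u s).

Let u_integrable : mu.-integrable `[0, 1] (EFin \o (fun s => 1 + u s)).
Proof.
apply: continuous_compact_integrable; first exact: segment_compact.
by move=> s; apply: cvgD; [exact: cvg_cst|exact: calH_continuous].
Qed.

Let U_continuous : {within `[0, 1], continuous U}.
Proof. exact: parameterized_integral_continuous ler01 u_integrable. Qed.

Let U0 : U 0 = 0. Proof. by rewrite /U set_itv1 Rintegral_set1. Qed.

Let U1 : U 1 = 1.
Proof.
have i1 : mu.-integrable `[0, 1] (EFin \o cst (1 : R)).
  apply: continuous_compact_integrable; first exact: segment_compact.
  by apply: continuous_subspaceT => s; exact: cvg_cst.
have iu : mu.-integrable `[0, 1] (EFin \o u).
  apply: continuous_compact_integrable; first exact: segment_compact.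
  exact: calH_continuous.
transitivity (\int[mu]_(s in `[0, 1]) (cst 1 s) + \int[mu]_(s in `[0, 1]) u s).
  exact: RintegralD.
rewrite calH_mean addr0 Rintegral_cst//.
by rewrite [X in _ * fine X]lebesgue_measure_itv/= lte_fin ltr01 -EFinB subr0 mulr1.
Qed.

Let U_is_derive x : 0 < x < 1 -> is_derive x 1 U (1 + u x).
Proof.
move=> /[dup] x01 /andP[x0 x1].
have cu : {for x, continuous (fun s => 1 + u s)}.
  apply: cvgD; first exact: cvg_cst.
  by apply: (within_continuous_continuous ltr01 (@calH_continuous _ u)); rewrite in_itv.
have [dU <-] := continuous_FTC1_closed x1 u_integrable x0 cu.
exact: derivable_is_derive.
Qed.

Let inv_stretch_is_derive x : 0 < x < 1 -> is_derive x 1 rho (du x / lam).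
Proof.
move=> x01; apply: (is_derive_eq (is_derive1M (is_derive1D (is_derive1_cst 1 x)
  (u_is_derive x01)) (is_derive1_cst lam^-1 x))).
by rewrite add0r mulr0 addr0.
Qed.

(** The gap between the graph of [Wstar] and the chord bounds [- du] from below
    by a multiple of [rho * sqrt (m - rho)], so that [sqrt (m - rho)] grows at
    least proportionally to [1 + u], whose integral is [1]. *)
Lemma multiplier_bound C : 0 < C -> (forall x, 1 < x -> C * W x <= W^`() x * x ^+ 4) ->
  k <= 6 / C * eps.
Proof.
move=> C0 WC; have k0 := multiplier_ge0.
have m0 : 0 < m by apply: inv_stretch_gt0.
have RHS0 : 0 <= 6 / C * eps by apply: ltW; rewrite mulr_gt0// divr_gt0.
(* If [m = 1] the profile starts at the bottom of the well and [k = 0]. *)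
have := inv_stretch_le1; rewrite le_eqVlt => /predU1P[m1|m1].
  by rewrite multiplierE m1 invr1 (W_at1 hW).
(* The growth rate: by the first integral and the gap, [(- du)^2] is at least
   [(2 q lam^2 rho)^2 (m - rho)]. *)
pose q := Num.sqrt (C * k * m / (6 * eps)).
have q2 : q ^+ 2 = C * k * m / (6 * eps).
  rewrite sqr_sqrtr//; apply: divr_ge0; last by apply: mulr_ge0 => //; exact: ltW.
  by apply: mulr_ge0; [apply: mulr_ge0 => //; exact: ltW|exact: ltW].
have q0 : 0 <= q by exact: sqrtr_ge0.
pose B x := Num.sqrt (m - rho x) - q * U x.
have : B 0 <= B 1.
  apply: (ge0_is_derive_le (df := fun x =>
    (2 * Num.sqrt (m - rho x))^-1 * (0 - du x / lam) - q * (1 + u x)) ler01) => [x x01|x x01|].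
  - have mr : 0 < m - rho x by rewrite subr_gt0; apply: inv_stretch_decreasing; lra.
    apply: is_derive1B; last by apply: is_derive1Z; exact: U_is_derive.
    apply: (is_derive1_chain (f := Num.sqrt)); first exact: is_derive1_sqrt.
    by apply: is_derive1B; exact: inv_stretch_is_derive.
  - have mr : 0 < m - rho x by rewrite subr_gt0; apply: inv_stretch_decreasing; lra.
    have rx : 0 < rho x by apply: inv_stretch_gt0; lra.
    have rm : rho x <= m by lra.
    have gap := WstarR_gap hW C0 WC rx rm m1.
    have := @first_integral x; rewrite -multiplierE in gap => fi.
    have {}fi := fi ltac:(lra); have du0 := slope_le0 x01.
    have uE : 1 + u x = lam * rho x by rewrite /inv_stretch; field; rewrite gt_eqF.
    set S := Num.sqrt (m - rho x).
    have S0 : 0 < S by rewrite sqrtr_gt0.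
    have X0 : 0 <= 2 * lam ^+ 2 * q * rho x * S.
      apply: mulr_ge0; last exact: ltW.
      apply: mulr_ge0; last exact: ltW.
      by apply: mulr_ge0 => //; apply: mulr_ge0 => //; apply: exprn_ge0; exact: ltW.
    have XY : 2 * lam ^+ 2 * q * rho x * S <= - du x.
      rewrite -(ler_pXn2r (n := 2)) ?nnegrE ?oppr_ge0// sqrrN.
      have -> : (2 * lam ^+ 2 * q * rho x * S) ^+ 2 =
          2 / eps * (lam ^+ 4 * (C / 3 * k * m * rho x ^+ 2 * (m - rho x))).
        by rewrite !exprMn q2 sqr_sqrtr ?(ltW mr)//; field; rewrite !gt_eqF.
      have -> : du x ^+ 2 = 2 / eps * (eps / 2 * du x ^+ 2).
        by field; rewrite gt_eqF.
      by rewrite fi !ler_pM2l ?divr_gt0 ?exprn_gt0.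
    have -> : (2 * S)^-1 * (0 - du x / lam) - q * (1 + u x) =
        (- du x - 2 * lam ^+ 2 * q * rho x * S) / (2 * S * lam).
      by rewrite uE; field; rewrite !gt_eqF.
    by apply: divr_ge0; [rewrite subr_ge0|apply: ltW; rewrite !mulr_gt0].
  - move=> x; apply: cvgB.
      apply: (within_continuous_comp_continuous (f := fun x => m - rho x) (g := Num.sqrt)).
        by move=> y; apply: cvgB; [exact: cvg_cst|exact: inv_stretch_continuous].
      exact: sqrt_continuous.
    by apply: cvgM; [exact: cvg_cst|exact: U_continuous].
rewrite /B U0 U1 subrr sqrtr0 inv_stretch1 subr0 mulr0 subrr mulr1 subr_ge0.
rewrite -(ler_pXn2r (n := 2)) ?nnegrE ?sqrtr_ge0// q2 sqr_sqrtr ?(ltW m0)//.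
rewrite ler_pdivrMr ?mulr_gt0// => H.
rewrite mulrAC ler_pdivlMr//.
by rewrite -(ler_pM2r m0); lra.
Qed.

Let phi t := Num.sqrt (2 * (WstarR W t - k * t)).
Let Psi h := \int[mu]_(t in `[0, h]) phi t.

Let phi_continuous : continuous phi.
Proof.
move=> t; apply: continuous_comp; last exact: sqrt_continuous.
apply: cvgM; first exact: cvg_cst.
apply: cvgB; first exact: (WstarR_continuous hW).
by apply: cvgM; [exact: cvg_cst|exact: cvg_id].
Qed.

Let phi_integrable h : mu.-integrable `[0, h] (EFin \o phi).
Proof.
apply: continuous_compact_integrable; first exact: segment_compact.
by apply: continuous_subspaceT; exact: phi_continuous.
Qed.

(** Beyond [m] the chord lies above the graph, where the square root vanishes. *)
Let Psi_m : Psi m = Psi 1.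
Proof.
have m0 : 0 < m by apply: inv_stretch_gt0.
apply/esym/eqP; rewrite -subr_eq0; apply/eqP; rewrite /Psi.
rewrite Rintegral_itvB ?bnd_simp ?(ltW m0) ?inv_stretch_le1//.
rewrite (@eq_Rintegral _ _ _ mu _ (cst 0)) ?Rintegral_cst ?mul0r//.
move=> t; rewrite inE/= in_itv/= => /andP[mt t1]; apply: ler0_sqrtr.
have t0 : 0 < t by lra.
suff : WstarR W t <= k * t by lra.
rewrite WstarR_gt0E// mulrC ler_pM2r// multiplierE.
by apply: (W_nondecreasing hW); rewrite ?invf_ge1// lef_pV2 ?posrE// ltW.
Qed.

Definition profile_energy y := eps / 2 * (du (y / lam) / lam ^+ 2) ^+ 2
  + WstarR W (rho (y / lam)).

Let scale_in y : 0 < y < lam -> 0 < y / lam < 1.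
Proof. by move=> /andP[y0 yl]; rewrite divr_gt0// ltr_pdivrMr// mul1r. Qed.

Let scale_within (f : R -> R) : {within `[0, 1], continuous f} ->
  {within `[0, lam], continuous (fun y => f (y / lam))}.
Proof.
move=> cf; apply: (within_continuous_comp_within (f := fun y => y / lam) _ _ cf).
  by apply: continuous_subspaceT => y; apply: cvgM; [exact: cvg_id|exact: cvg_cst].
move=> y; rewrite /= !in_itv/= => /andP[y0 yl].
by rewrite divr_ge0 ?(ltW lam_gt0)// ler_pdivrMr// mul1r.
Qed.

Let profile_energy_continuous : {within `[0, lam], continuous profile_energy}.
Proof.
apply: (scale_within (f := fun x => eps / 2 * (du x / lam ^+ 2) ^+ 2 + WstarR W (rho x))).
move=> x; apply: cvgD.
  apply: cvgM; first exact: cvg_cst.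
  apply: (within_continuous_comp_continuous (f := fun x => du x / lam ^+ 2)
    (g := fun z => z ^+ 2)); last exact: exprn_continuous.
  by move=> z; apply: cvgM; [exact: slope_continuous|exact: cvg_cst].
apply: (within_continuous_comp_continuous inv_stretch_continuous).
exact: (WstarR_continuous hW).
Qed.

(** On the unbroken part the energy density is the derivative of
    [k * U - sqrt eps * Psi (H)], because [sqrt eps * H' = - sqrt (2 (Wstar H - k H))]
    turns the gradient term into an integral in the variable [H]. *)
Lemma profile_energy_integral :
  (\int[mu]_(y in `[0%R, lam]) (profile_energy y)%:E =
   (Num.sqrt eps * Psi 1 + k)%:E)%E.
Proof.
pose A y := k * U (y / lam) - Num.sqrt eps * Psi (rho (y / lam)).
have ce := profile_energy_continuous.
have cA : {within `[0, lam], continuous A}.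
  apply: (scale_within (f := fun x => k * U x - Num.sqrt eps * Psi (rho x))).
  have Psi_comp : {within `[0, 1], continuous (fun x => Psi (rho x))}.
    have m0 : 0 <= m by apply: ltW; apply: inv_stretch_gt0.
    apply: (within_continuous_comp_within inv_stretch_continuous (B := `[0, m]%classic)).
      move=> x; rewrite /= !in_itv/= => /andP[x0 x1]; apply/andP; split.
        move: x1; rewrite le_eqVlt => /predU1P[->|x1]; first by rewrite inv_stretch1.
        by apply: ltW; apply: inv_stretch_gt0.
      move: x0; rewrite le_eqVlt => /predU1P[<-//|x0].
      by apply: ltW; apply: inv_stretch_decreasing.
    exact: parameterized_integral_continuous m0 (phi_integrable m).
  move=> x; apply: cvgB; (apply: cvgM; first exact: cvg_cst).
    exact: U_continuous.
  exact: Psi_comp.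
have dA y : 0 < y < lam -> is_derive y 1 A (profile_energy y).
  move=> ylam; have x01 := scale_in ylam; set x := y / lam in x01 *.
  have dlin : is_derive y 1 (fun y => y / lam) lam^-1.
    apply: (is_derive_eq (is_derive1M (is_derive1_id y) (is_derive1_cst lam^-1 y))).
    by rewrite mul1r mulr0 addr0.
  have dU : is_derive y 1 (fun y => U (y / lam)) ((1 + u x) / lam).
    by apply: (is_derive1_chain _ dlin); exact: U_is_derive.
  have dr : is_derive y 1 (fun y => rho (y / lam)) (du x / lam / lam).
    by apply: (is_derive1_chain _ dlin); exact: inv_stretch_is_derive.
  have rx : 0 < rho x by apply: inv_stretch_gt0; lra.
  have dPsi : is_derive (rho x) 1 Psi (phi (rho x)).
    have r1 : rho x < rho x + 1 by rewrite ltrDl.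
    have [dP <-] := continuous_FTC1_closed r1 (phi_integrable _) rx
      (@phi_continuous _).
    exact: derivable_is_derive.
  have phiE : phi (rho x) = Num.sqrt eps * (- du x / lam ^+ 2).
    have du0 : 0 <= - du x / lam ^+ 2.
      by rewrite divr_ge0 ?exprn_ge0 ?(ltW lam_gt0)// oppr_ge0 slope_le0.
    rewrite -[- du x / _]ger0_norm// -sqrtr_sqr -sqrtrM ?(ltW eps_gt0)//; congr Num.sqrt.
    have fi := first_integral (x := x) ltac:(lra).
    have -> : WstarR W (rho x) - k * rho x = eps / 2 * du x ^+ 2 / lam ^+ 4.
      by rewrite fi; field; rewrite gt_eqF.
    by field; rewrite gt_eqF.
  have dPr := is_derive1_chain (f := Psi) (g := fun y => rho (y / lam)) dPsi dr.
  apply: (is_derive_eq (is_derive1B (is_derive1Z k dU) (is_derive1Z (Num.sqrt eps) dPr))).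
  have fi := first_integral (x := x) ltac:(lra).
  have -> : Num.sqrt eps * (phi (rho x) * (du x / lam / lam)) =
      - (Num.sqrt eps ^+ 2 * du x ^+ 2 / lam ^+ 4).
    by rewrite phiE; field; rewrite gt_eqF.
  rewrite sqr_sqrtr ?(ltW eps_gt0)// /profile_energy -/x.
  have -> : WstarR W (rho x) = k * rho x + eps / 2 * du x ^+ 2 / lam ^+ 4.
    by rewrite fi; field; rewrite gt_eqF.
  by rewrite /inv_stretch; field; rewrite gt_eqF.
rewrite (continuous_FTC2 lam_gt0 ce (F := A)).
- rewrite -EFinB; congr EFin; rewrite /A mul0r divff ?gt_eqF// U0 U1 inv_stretch1 -/m Psi_m.
  by rewrite {1}/Psi set_itv1 Rintegral_set1; ring.
- have [_ A0 Al] := (continuous_within_itvP _ lam_gt0).1 cA.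
  split; [move=> y|exact: A0|exact: Al].
  by rewrite in_itv/= => /dA; exact: is_derive_derivable.
- by move=> y; rewrite in_itv/= => /dA; exact: is_derive1E.
Qed.

Lemma Wstar_ge0E H : 0 <= H -> Wstar W H = (WstarR W H)%:E.
Proof.
by move=> H0; rewrite /WstarR /Wstar ltNge H0/=; case: ifP.
Qed.

(** The broken part contributes nothing since [Wstar 0 = 0]. The derivative of the
    broken solution is only controlled off the end points of its two pieces, so the
    integrals are compared on open intervals. *)
Lemma broken_solution_energy lam' : lam < lam' ->
  energy W eps lam' (broken_solution lam u) =
  (Num.sqrt eps * \int[mu]_(t in `[0, 1]) Num.sqrt (2 * (WstarR W t - k * t)) + k)%:E.
Proof.
move=> ll'; rewrite -profile_energy_integral /energy.
set H := broken_solution lam u.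
pose F y : \bar R := ((eps / 2 * H^`() y ^+ 2)%:E + Wstar W (H y))%E.
have H_left y : y <= lam -> H y = rho (y / lam) by rewrite /H /broken_solution => ->.
have H_right y : lam < y -> H y = 0 by rewrite /H /broken_solution leNgt => ->.
have F1 y : 0 < y < lam -> F y = (profile_energy y)%:E.
  move=> ylam; have x01 := scale_in ylam; have [y0 yl] := andP ylam.
  have dH : is_derive y 1 H (du (y / lam) / lam ^+ 2).
    apply: (@near_eq_is_derive _ _ (fun y => rho (y / lam))).
      by near=> z; apply: H_left; near: z; exact: lt_le_nbhsl.
    have dlin : is_derive y 1 (fun y => y / lam) lam^-1.
      apply: (is_derive_eq (is_derive1M (is_derive1_id y) (is_derive1_cst lam^-1 y))).
      by rewrite mul1r mulr0 addr0.
    apply: (is_derive_eq (is_derive1_chain (f := rho) (g := fun y => y / lam)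
      (inv_stretch_is_derive x01) dlin)).
    by field; rewrite gt_eqF.
  rewrite /F (is_derive1E dH) H_left ?(ltW yl)// Wstar_ge0E//.
  by apply: ltW; apply: inv_stretch_gt0; lra.
have F2 y : lam < y -> F y = 0%E.
  move=> ly; have dH : is_derive y 1 H 0.
    apply: (@near_eq_is_derive _ _ (fun=> 0)).
    by near=> z; apply: H_right; near: z; exact: lt_nbhsr.
  by rewrite /F (is_derive1E dH) H_right// Wstar_ge0E// WstarR0 expr0n mulr0 adde0.
have H_ge0 y : 0 <= y -> 0 <= H y.
  move=> y0; have [yl|ly] := leP y lam; last by rewrite H_right.
  rewrite H_left//; have x0 : 0 <= y / lam by rewrite divr_ge0// ltW.
  have : y / lam <= 1 by rewrite ler_pdivrMr// mul1r.
  by rewrite le_eqVlt => /predU1P[->|x1]; [rewrite inv_stretch1|apply: ltW; exact: inv_stretch_gt0].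
have F_ge0 y : 0 <= y -> (0 <= F y)%E.
  move=> y0; apply: adde_ge0.
    by rewrite lee_fin mulr_ge0 ?sqr_ge0// divr_ge0// ltW.
  by rewrite Wstar_ge0E ?H_ge0// lee_fin (WstarR_ge0 hW)// H_ge0.
have mI a b : measurable (`]a, b[%classic : set (measurableTypeR R)) by exact: measurable_itv.
have mE : measurable_fun (`]0, lam[%classic : set (measurableTypeR R)) profile_energy.
  have : mu.-integrable `[0, lam] (EFin \o profile_energy).
    apply: continuous_compact_integrable; first exact: segment_compact.
    exact: profile_energy_continuous.
  move=> /integrableP[/measurable_EFinP me _].
  by apply: measurable_funS me => //; exact: subset_itv_oo_cc.
have mF1 : measurable_fun (`]0, lam[%classic : set (measurableTypeR R)) F.
  apply: (@eq_measurable_fun _ _ _ _ _ (EFin \o profile_energy)); last exact/measurable_EFinP.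
  by move=> y; rewrite inE/= in_itv/= => /F1 ->.
have mF2 : measurable_fun (`]lam, lam'[%classic : set (measurableTypeR R)) F.
  apply: (@eq_measurable_fun _ _ _ _ _ (cst 0%E)); last exact: measurable_cst.
  by move=> y; rewrite inE/= in_itv/= => /andP[/F2 -> _].
have mF1o : measurable_fun (`[0, lam[%classic : set (measurableTypeR R)) F.
  exact/emeasurable_fun_itv_obnd_cbndP.
have mF1c : measurable_fun (`[0, lam]%classic : set (measurableTypeR R)) F.
  exact/emeasurable_fun_itv_bndo_bndcP.
have mF2c : measurable_fun (`]lam, lam']%classic : set (measurableTypeR R)) F.
  exact/emeasurable_fun_itv_bndo_bndcP.
have -> : `[0, lam']%classic = `[0, lam] `|` `]lam, lam'].
  apply/seteqP; split=> y; rewrite /= !in_itv/=.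
    by move=> /andP[y0 yl]; have [yl'|ly] := leP y lam; [left|right]; rewrite ?y0.
  by have := lam_gt0; move=> l0 [] /andP[y0 yl]; apply/andP; split=> //; lra.
rewrite (@ge0_integral_setU _ _ _ mu) => //; last 3 first.
- exact/measurable_funU.
- move=> y; rewrite /= !in_itv/= => -[] /andP[y0 _]; apply: F_ge0 => //.
  by apply: ltW; apply: lt_trans y0.
- apply/disj_setPS => y [/=]; rewrite !in_itv/= => /andP[_ yl] /andP[ly _].
  by move: (le_lt_trans yl ly); rewrite ltxx.
rewrite [X in (_ + X)%E](_ : _ = 0%E) ?adde0; last first.
  rewrite -integral_itv_bndo_bndc//; apply: integral0_eq => y.
  by rewrite /= in_itv/= => /andP[/F2].
rewrite -[LHS]integral_itv_bndo_bndc// -[LHS]integral_itv_obnd_cbnd//.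
rewrite -[RHS]integral_itv_bndo_bndc; last first.
  by apply/emeasurable_fun_itv_obnd_cbndP/measurable_EFinP.
rewrite -[RHS]integral_itv_obnd_cbnd; last exact/measurable_EFinP.
by apply: eq_integral => y; rewrite inE/= in_itv/= => /F1.
Unshelve. all: by end_near. Qed.

Lemma broken_energy_expansion C lam' : lam < lam' ->
  0 < C -> (forall x, 1 < x -> C * W x <= W^`() x * x ^+ 4) ->
  exists2 q, 0 <= q <= 6 / C * eps &
    energy W eps lam' (broken_solution lam u) =
    (Num.sqrt eps * \int[mu]_(t in `[0, 1]) Num.sqrt (2 * (WstarR W t - q * t)) + q)%:E.
Proof.
move=> ll' C0 WC; exists k; last exact: broken_solution_energy.
by rewrite multiplier_ge0; exact: multiplier_bound.
Qed.

End fractured_solution.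
(** * Consequences of the characteristic equation, and the limit integrals *)

Section asymptotics.
Context {R : realType} (W : R -> R) (gamma kappa : R).
Hypothesis hW : stored_energy W gamma kappa.
Local Notation mu := (@lebesgue_measure R).

(** In the variable [F = 1/H] the characteristic equation for [n = 1] reads
    [eps * pi^2 = - W'' F * F^5]; as it has a single root for every [eps], the right
    hand side takes every positive value exactly once. *)
Lemma roots_growth (l : R -> nat -> R) :
  (forall eps, 0 < eps -> characteristic_roots W kappa eps (l eps)) ->
  exists2 C, 0 < C & forall x, 1 < x -> C * W x <= W^`() x * x ^+ 4.
Proof.
move=> hl.
have kappa0 := kappa_gt0 hW.
have pi2 : 0 < (pi : R) ^+ 2 by rewrite exprn_gt0// pi_gt0.
have rootE eps x : 0 < eps -> 0 < x ->
    (- W^`(2) x * x ^+ 5 = eps * pi ^+ 2) <-> x = l eps 1%N.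
  move=> e0 x0; rewrite -(root_unique (hl _ e0) (n := 1) (lam := x))//.
  have -> : (WstarR W)^`(2) x^-1 = W^`(2) x * x ^+ 3.
    have xV : 0 < x^-1 by rewrite invr_gt0.
    have -> : (WstarR W)^`(2) x^-1 = W^`(2) x^-1^-1 / x^-1 ^+ 3.
      exact: is_derive1E (WstarR_is_derive2 hW xV).
    by rewrite invrK exprVn invrK.
  rewrite expr1n mulr1; split=> [<-|E]; first by field; rewrite gt_eqF.
  have x2 : x ^+ 2 != 0 by rewrite expf_neq0// gt_eqF.
  by have := congr1 ( *%R^~ (x ^+ 2)) E; rewrite divfK// => ->; ring.
have kF1 := root1_gt (hl 1 ltr01).
have F10 : 0 < l 1 1%N by apply: lt_trans kF1; rewrite invr_gt0.
apply: (W_growth hW pi2 kF1); apply: (W2_le hW) => //.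
  by rewrite (rootE 1 (l 1 1%N) ltr01 F10).2// mul1r.
move=> v x y v0 x0 y0 Ex Ey.
have e0 : 0 < v / pi ^+ 2 by rewrite divr_gt0.
rewrite ((rootE _ x e0 x0).1 _); first by rewrite ((rootE _ y e0 y0).1 _)// divfK// gt_eqF.
by rewrite divfK// gt_eqF.
Qed.

Lemma well_continuous : continuous (fun t => Num.sqrt (2 * WstarR W t)).
Proof.
move=> t; apply: continuous_comp; last exact: sqrt_continuous.
by apply: cvgM; [exact: cvg_cst|exact: (WstarR_continuous hW)].
Qed.

Lemma continuous_Rintegral (f : R -> R) (a b : R) : continuous f ->
  (\int[mu]_(t in `[a, b]) (f t)%:E = (\int[mu]_(t in `[a, b]) f t)%:E)%E.
Proof.
move=> cf; rewrite /Rintegral fineK//; apply: integrable_fin_num => //.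
apply: continuous_compact_integrable; first exact: segment_compact.
by apply: continuous_subspaceT; exact: cf.
Qed.

(** Substitution [F = 1/H]. *)
Lemma well_integral_stretch :
  (\int[mu]_(F in `[1%R, +oo[) (Num.sqrt (2 * W F / F ^+ 5))%:E =
   (\int[mu]_(t in `[0, 1]) Num.sqrt (2 * WstarR W t))%:E)%E.
Proof.
pose phi t := Num.sqrt (2 * WstarR W t).
pose Psi h := \int[mu]_(t in `[0, h]) phi t.
have phi_int h : mu.-integrable `[0, h] (EFin \o phi).
  apply: continuous_compact_integrable; first exact: segment_compact.
  by apply: continuous_subspaceT; exact: well_continuous.
have dPsi (h : R) : 0 < h -> is_derive h 1 Psi (phi h).
  move=> h0; have h1 : h < h + 1 by rewrite ltrDl.
  have [dP <-] := continuous_FTC1_closed h1 (phi_int _) h0 (@well_continuous _).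
  exact: derivable_is_derive.
pose A (x : R) : R := - Psi x^-1.
have dA (x : R) : 0 < x -> is_derive x 1 A (Num.sqrt (2 * W x / x ^+ 5)).
  move=> x0; have dV := is_derive1V (lt0r_neq0 x0) (is_derive1_id x).
  have xV : 0 < x^-1 by rewrite invr_gt0.
  apply: (is_derive_eq (is_derive1N (is_derive1_chain (f := Psi) (g := fun x => x^-1)
    (dPsi _ xV) dV))).
  rewrite mulN1r mulrN opprK /phi WstarR_gt0E// invrK.
  have -> : (x ^+ 2)^-1 = Num.sqrt ((x ^+ 2)^-1 ^+ 2).
    by rewrite sqrtr_sqr ger0_norm// invr_ge0 exprn_ge0// ltW.
  rewrite -sqrtrM; last by rewrite !mulr_ge0// ?invr_ge0 ?(ltW x0)// (W_ge0 hW).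
  by congr Num.sqrt; field; rewrite gt_eqF.
rewrite (@ge0_continuous_FTC2y _ _ A 1 0).
- by rewrite /A invr1 sub0e EFinN oppeK.
- by move=> x _; exact: sqrtr_ge0.
- apply: continuous_in_subspaceT => x; rewrite inE/= in_itv/= andbT => x1.
  have x0 : 0 < x by lra.
  apply: continuous_comp; last exact: sqrt_continuous.
  have x5 : x ^+ 5 != 0 by rewrite expf_neq0// gt_eqF.
  exact: (is_derive_continuous (is_derive1M (is_derive1Z 2 (W_is_derive hW x0))
    (is_derive1V (f := fun y => y ^+ 5) x5 (is_derive1X 5 (is_derive1_id x))))).
- have [_ + _] := (continuous_within_itvP _ (@ltr01 R)).1
    (parameterized_integral_continuous ler01 (phi_int 1)).
  rewrite /parameterized_integral set_itv1 Rintegral_set1.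
  move=> /cvgr0Pnorm_le Psi0; apply/cvgr0Pnorm_le => e e0.
  have [d /= d0 Hd] := Psi0 _ e0; near=> x.
  have dx : d^-1 < x by near: x; apply: nbhs_pinfty_gt; exact: num_real.
  have x0 : 0 < x by apply: lt_trans dx; rewrite invr_gt0.
  rewrite /A normrN; apply: Hd; last by rewrite invr_gt0.
  rewrite /ball_/= sub0r normrN gtr0_norm ?invr_gt0//.
  by rewrite -[ltRHS]invrK ltf_pV2 ?posrE// invr_gt0.
- by move=> x x1; apply: is_derive_derivable (dA _ _); lra.
- exact/cvg_at_right_filter/(is_derive_continuous (dA 1 ltr01)).
- by move=> x; rewrite in_itv/= andbT => x1; apply: is_derive1E (dA _ _); lra.
Unshelve. all: by end_near. Qed.

Let sqrt_subr_dist (a b : R) : 0 <= a -> 0 <= b ->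
  `|Num.sqrt (a - b) - Num.sqrt a| <= Num.sqrt b.
Proof.
move=> a0 b0; have le1 : Num.sqrt (a - b) <= Num.sqrt a by apply: ler_wsqrtr; lra.
rewrite ler0_norm ?subr_le0// opprB lerBlDl.
rewrite -(ler_pXn2r (n := 2)) ?nnegrE ?addr_ge0 ?sqrtr_ge0//.
rewrite sqrrD (sqr_sqrtr a0) (sqr_sqrtr b0).
have := sqrtr_ge0 b; have := sqrtr_ge0 (a - b); set p := Num.sqrt (a - b) => p0 q0.
have : a - b <= p ^+ 2.
  have [ab|ab] := leP 0 (a - b); first by rewrite sqr_sqrtr.
  by apply: le_trans (sqr_ge0 p); exact: ltW.
by have := mulr_ge0 p0 q0; lra.
Qed.

(** The integrands differ by at most [sqrt (2 k t)]; this includes the range where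
    the chord is above the graph and [Num.sqrt] of a negative number is [0]. *)
Lemma well_integral_bound (k : R) : 0 <= k ->
  `|\int[mu]_(t in `[0, 1]) Num.sqrt (2 * (WstarR W t - k * t)) -
    \int[mu]_(t in `[0, 1]) Num.sqrt (2 * WstarR W t)| <= Num.sqrt (2 * k).
Proof.
move=> k0; have c1 : continuous (fun t => Num.sqrt (2 * (WstarR W t - k * t))).
  move=> t; apply: continuous_comp; last exact: sqrt_continuous.
  apply: cvgM; first exact: cvg_cst.
  apply: cvgB; first exact: (WstarR_continuous hW).
  by apply: cvgM; [exact: cvg_cst|exact: cvg_id].
have ci (f : R -> R) : continuous f -> mu.-integrable `[0, 1] (EFin \o f).
  move=> cf; apply: continuous_compact_integrable; first exact: segment_compact.
  by apply: continuous_subspaceT; exact: cf.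
rewrite -RintegralB//; [|exact: ci|exact: (ci _ well_continuous)].
pose d t := Num.sqrt (2 * (WstarR W t - k * t)) - Num.sqrt (2 * WstarR W t).
have cd : continuous d by move=> t; apply: cvgB; [exact: c1|exact: well_continuous].
have cn : continuous (fun t => `|d t|).
  move=> t; apply: (@cvg_comp _ _ _ d (fun x : R => `|x|) _ (nbhs (d t))); first exact: cd.
  exact: norm_continuous.
apply: le_trans (le_normr_Rintegral _ (ci _ cd)) _ => //.
apply: (@le_trans _ _ (\int[mu]_(t in `[0, 1]) cst (Num.sqrt (2 * k)) t)).
  apply: le_Rintegral => //.
  - exact: ci cn.
  - by apply: ci => t; exact: cvg_cst.
  - move=> t; rewrite /= in_itv/= => /andP[t0 t1].
    rewrite /d mulrBr; apply: le_trans (sqrt_subr_dist _ _) _.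
    + by rewrite mulr_ge0// (WstarR_ge0 hW).
    + by rewrite !mulr_ge0.
    + by apply: ler_wsqrtr; rewrite ler_pM2l// ler_piMr.
rewrite Rintegral_cst//.
by rewrite [X in _ * fine X]lebesgue_measure_itv/= lte_fin ltr01 -EFinB subr0 mulr1.
Qed.

End asymptotics.
(** * The energy of broken solutions *)

(** In the reference variable [s = y / lam] the unbroken part is a decreasing
    function on [0, 1] touching the constraint at [s = 1]. *)
Lemma fracture_point_decreasing (R : realType) (W : R -> R) (gamma eps lam1 lam : R)
    (u : calH R) : fracture_point W gamma eps lam1 lam u ->
  (forall x y : R, 0 <= x -> x < y -> y <= 1 -> u y < u x) /\ u 1 = -1.
Proof.
case=> _ [lam0 _ _] _ _ mono; rewrite /inverse_stretch divff ?gt_eqF// => u1.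
have lamE (x : R) : lam * x / lam = x by rewrite mulrC mulrA mulVf ?mul1r// gt_eqF.
split=> [x y x0 xy y1|]; last first.
  by move/eqP: u1; rewrite mulf_eq0 invr_eq0 (gt_eqF lam0) orbF addr_eq0 -eqr_oppLR => /eqP<-.
have inlam z : 0 <= z <= 1 -> lam * z \in `[0, lam]%classic.
  by move=> /andP[z0 z1]; rewrite inE/= in_itv/= mulr_ge0 ?(ltW lam0)//= ler_piMr// ltW.
have xin := inlam x ltac:(lra); have yin := inlam y ltac:(lra).
have := mono (lam * y) (lam * x) yin xin.
by rewrite ltr_pM2l// /inverse_stretch !lamE ltr_pM2r ?invr_gt0// ltrD2l; apply.
Qed.

Theorem proposition5p7 (R : realType) (W : R -> R) (gamma kappa : R)
    (hW : stored_energy W gamma kappa)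
    (l : R -> nat -> R)
    (hl : forall eps, 0 < eps -> characteristic_roots W kappa eps (l eps))
    (lams : R -> R) (us : R -> calH R)
    (hfrac : forall eps, 0 < eps ->
       fracture_point W gamma eps (l eps 1%N) (lams eps) (us eps))
    (lam : R -> R)
    (hlam : \forall eps \near 0^'+, lams eps < lam eps) :
  exists c : R,
    [/\ (\int[@lebesgue_measure R]_(H in `[0%R, 1%R])
           (Num.sqrt (2 * WstarR W H))%:E)%E = c%:E,
        (\int[@lebesgue_measure R]_(F in `[1%R, +oo[)
           (Num.sqrt (2 * W F / F ^+ 5))%:E)%E = c%:E &
        exists r : R -> R,
          (forall eps, r eps =o_(eps \near 0^'+) Num.sqrt eps) /\
          \forall eps \near 0^'+,
            energy W eps (lam eps) (broken_solution (lams eps) (us eps)) =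
            (Num.sqrt eps * c + r eps)%:E].
Proof.
have [C C0 WC] := roots_growth hW hl.
pose D := 6 / C; have D0 : 0 < D by rewrite divr_gt0.
pose c := \int[@lebesgue_measure R]_(t in `[0, 1]) Num.sqrt (2 * WstarR W t).
pose E eps := energy W eps (lam eps) (broken_solution (lams eps) (us eps)).
pose r eps := fine (E eps) - Num.sqrt eps * c.
have rbound : \forall eps \near 0^'+,
    E eps = (Num.sqrt eps * c + r eps)%:E /\ `|r eps| <= (Num.sqrt (2 * D) + D) * eps.
  near=> eps.
  have e0 : 0 < eps by near: eps; exact: nbhs_right_gt.
  have ll : lams eps < lam eps by near: eps.
  have fr := hfrac _ e0; have [udec u1] := fracture_point_decreasing fr.
  have [q /andP[q0 qD] EE] := broken_energy_expansion hW e0 (fracture_solution fr)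
    udec u1 ll C0 WC.
  rewrite /r /E EE /=; split; first by congr EFin; ring.
  pose P := \int[@lebesgue_measure R]_(t in `[0, 1]) Num.sqrt (2 * (WstarR W t - q * t)).
  have Pc : `|P - c| <= Num.sqrt (2 * q) := well_integral_bound hW q0.
  rewrite -/P.
  have -> : Num.sqrt eps * P + q - Num.sqrt eps * c = Num.sqrt eps * (P - c) + q by ring.
  apply: le_trans (ler_normD _ _) _; rewrite mulrDl; apply: lerD; last by rewrite ger0_norm.
  have eE : eps = Num.sqrt eps * Num.sqrt eps by rewrite -expr2 sqr_sqrtr// ltW.
  rewrite normrM ger0_norm ?sqrtr_ge0// [in leRHS]eE mulrCA ler_pM2l ?sqrtr_gt0//.
  apply: le_trans Pc _; rewrite -sqrtrM; last by rewrite mulr_ge0// ltW.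
  by apply: ler_wsqrtr; rewrite -mulrA ler_pM2l.
exists c; split.
- by rewrite continuous_Rintegral//; exact: well_continuous hW.
- exact: well_integral_stretch hW.
- exists r; split; last by apply: filterS rbound => eps [].
  move=> eps; rewrite littleoE// => e e_gt0.
  pose B := Num.sqrt (2 * D) + D.
  have B0 : 0 < B by rewrite ltr_wpDl ?sqrtr_ge0.
  (* [r t] is even of order [t]. *)
  near=> t.
  have t0 : 0 < t by near: t; exact: nbhs_right_gt.
  have [_ rt] : E t = (Num.sqrt t * c + r t)%:E /\ `|r t| <= (Num.sqrt (2 * D) + D) * t.
    by near: t.
  apply: le_trans rt _; rewrite -/B [`|Num.sqrt t|]ger0_norm ?sqrtr_ge0//.
  have tE : t = Num.sqrt t * Num.sqrt t by rewrite -expr2 sqr_sqrtr// ltW.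
  rewrite [in leLHS]tE mulrA ler_pM2r ?sqrtr_gt0// -ler_pdivlMl//.
  rewrite -[leRHS]ger0_norm ?mulr_ge0 ?invr_ge0 ?(ltW B0) ?(ltW e_gt0)// -sqrtr_sqr.
  apply: ler_wsqrtr; apply: ltW; near: t; apply: nbhs_right_lt.
  by rewrite exprn_gt0// mulr_gt0// invr_gt0.
Unshelve. all: by end_near. Qed.
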